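(* Let $E \subseteq \mathbb{R}$ be a nonempty open interval, let $H \colon E \to H(E)$ be a differentiable and strictly monotone function, let $\alpha,\beta \in (0,1)$ satisfy $\alpha+\beta=1$, and let $h \colon E\times E \to \mathbb{R}$ be given by $h(x,y)=H^{-1}(\alpha H(x)+\beta H(y))$ for all $x,y\in E$. Let $\varphi,\psi \colon E\to\mathbb{R}$ be differentiable functions such that for all $x,y\in E$ with $x<y$, $$[\varphi(y)-\varphi(x)]\,\psi'\bigl(h(x,y)\bigr)=[\psi(y)-\psi(x)]\,\varphi'\bigl(h(x,y)\bigr).$$ Then (at least) one of the following possibilities holds: (a) $\{1,\varphi,\psi\}$ are linearly dependent on every open subinterval of $E$ on which $\psi'$ does not vanish; moreover, if $J=H(E)$ is a semi-infinite interval, then $\{1,\varphi,\psi\}$ are linearly dependent on $E$; (b) $\varphi,\psi\in\mathrm{span}\{1,H,H^2\}$ on $E$; (c) there exists a non-zero real number $\mu$ such that $\varphi,\psi\in\mathrm{span}\{1,e^{\mu H},e^{-\mu H}\}$ on $E$; (d) there exists a non-zero real number $\mu$ such that $\varphi,\psi\in\mathrm{span}\{1,\sin(\mu H),\cos(\mu H)\}$ on $E$.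
   Context: An interval $J$ is called semi-infinite if $\inf(J)=-\infty$ or $\sup(J)=+\infty$. Functions are linearly dependent on a set $S$ if their restrictions to $S$ are linearly dependent over $\mathbb{R}$ (here $1$ denotes the constant function). Spans are real linear spans. *)

(* Defs.v *)
From mathcomp Require Import all_boot all_order all_algebra.
From mathcomp Require Import all_classical all_reals all_analysis.

Set Implicit Arguments.
Unset Strict Implicit.
Unset Printing Implicit Defensive.

Import Order.TTheory GRing.Theory Num.Theory.
Import numFieldNormedType.Exports.

Local Open Scope classical_set_scope.
Local Open Scope ring_scope.

Definition semi_infinite (R : realType) (J : set R) : Prop :=
  ereal_inf (EFin @` J) = -oo%E \/ ereal_sup (EFin @` J) = +oo%E.

Definition strictly_monotone_on (R : realType) (E : set R) (f : R -> R) : Prop :=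
  {in E &, {homo f : x y / x < y}} \/ {in E &, {homo f : x y /~ x < y}}.

(* Dependence of an indexed family: a repeated function counts as a
   dependence relation. *)
Definition lin_dep_on (R : realType) (S : set R) (n : nat)
    (f : n.-tuple (R -> R)) : Prop :=
  exists2 c : 'I_n -> R, (exists i, c i != 0) &
    forall x, S x -> \sum_(i < n) c i * tnth f i x = 0.

Definition in_span_on (R : realType) (S : set R) (n : nat)
    (f : n.-tuple (R -> R)) (g : R -> R) : Prop :=
  exists c : 'I_n -> R, forall x, S x -> g x = \sum_(i < n) c i * tnth f i x.

(* Main.v *)
Require Import Defs.
From mathcomp Require Import all_boot all_order all_algebra.
From mathcomp Require Import all_classical all_reals all_analysis.
From mathcomp Require Import ring lra.

Set Implicit Arguments.
Unset Strict Implicit.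
Unset Printing Implicit Defensive.

Import Order.TTheory GRing.Theory Num.Theory.
Import numFieldNormedType.Exports.

Local Open Scope classical_set_scope.
Local Open Scope ring_scope.

(** The equation is about the plane curve [(phi, psi)]. In the variable [u = H
    x], of which its coordinates are functions [f] and [g], the chord from [u]
    to [v] is parallel to the tangent at [w = al * u + be * v]; call it a chord
    over [w]. Thus all chords over a point with a nonzero tangent are parallel,
    and by continuity so are those over a limit of such points
    ([fiber_parallel]). The derivative of [H] may vanish on a dense set, so in
    the variable [u] the curve is only continuous at first; it is differentiable
    at a dense set of points. Everything depends on whether some interval
    contains no subinterval that the curve maps into a line.

    Suppose there is such an interval. Around a chord whose ends differ, the
    chords over [w] have a common slope [K w]. With one end held fixed at a
    point of differentiability, the quotient of increments shows that [K] is
    differentiable everywhere; since [K] is not locally constant, two chords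
    ending at [v] have different slopes and express [f v] and [g v] through
    [K], so the curve is differentiable too, and a linear change of coordinates
    makes one derivative nonzero ([regular_subinterval]). There, the
    derivatives of the chord formula with respect to each end improve the
    regularity of the curve and of [K] alternately. Shrinking chords to a point
    gives [al ^+ 2 = be ^+ 2], so the weights are equal ([regular_weights]);
    the defect [f - K w * g] is then symmetric about [w], so the third
    derivatives satisfy the same relation as the first ones, and their ratio is
    the same at both ends of each chord, hence a constant [c]
    ([third_derivative_ratio]). The solutions of the resulting linear equation are
    the quadratic, exponential and trigonometric families ([ode3_model]). The
    solution continues to the whole interval because, for [y] outside the known
    part, reflecting [y] in known points [w] puts the error at [y] in the
    direction of the tangent at [w], and this direction varies with [w]
    ([agree_extends]).

    Otherwise every interval contains a straight piece. A point with a nonzero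
    tangent inside a straight piece forces all chords over it, however long, to
    have the direction of the line ([line_step]). If no tangent vanishes, the
    piece therefore grows in both directions ([collinear_active]), which is the
    first half of (a). In general, a straight piece that is maximal on its right
    is constant near its right end, and one that is maximal on both sides would
    be constant and could still be extended ([not_doubly_stuck]). So a maximal
    piece reaches an end of the domain, and if the domain is unbounded this
    leaves only the whole of it ([collinear_unbounded]). *)

(** * Derivatives and continuity of real functions *)

Section Analysis.
Context {R : realType}.
Implicit Types (f g : R -> R) (x y s t a b c d e : R).

Lemma drv_cst c x : is_derive x 1 (fun=> c) 0.
Proof. exact: is_derive_cst. Qed.

Lemma drv_id x : is_derive x 1 (fun y => y) 1.
Proof. exact: is_derive_id. Qed.

Lemma drvN f x a : is_derive x 1 f a -> is_derive x 1 (fun y => - f y) (- a).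
Proof. by move=> fa; exact: is_deriveN. Qed.

Lemma drvD f g x a b : is_derive x 1 f a -> is_derive x 1 g b ->
  is_derive x 1 (fun y => f y + g y) (a + b).
Proof. by move=> fa gb; exact: is_deriveD. Qed.

Lemma drvB f g x a b : is_derive x 1 f a -> is_derive x 1 g b ->
  is_derive x 1 (fun y => f y - g y) (a - b).
Proof. by move=> fa gb; exact: is_deriveB. Qed.

Lemma drvM f g x a b : is_derive x 1 f a -> is_derive x 1 g b ->
  is_derive x 1 (fun y => f y * g y) (a * g x + f x * b).
Proof.
move=> fa gb; apply: is_derive_eq (is_deriveM fa gb) _.
by rewrite /GRing.scale /=; ring.
Qed.

Lemma drvV f x a : f x != 0 -> is_derive x 1 f a ->
  is_derive x 1 (fun y => (f y)^-1) (- a / f x ^+ 2).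
Proof.
move=> f0 fa; apply: is_derive_eq (is_deriveV f0 fa) _.
by rewrite /GRing.scale /= mulNr mulrC -mulNr.
Qed.

Lemma drv_comp f g x a b : is_derive (g x) 1 f a -> is_derive x 1 g b ->
  is_derive x 1 (fun y => f (g y)) (a * b).
Proof. by move=> fa gb; exact: is_derive1_comp. Qed.

Lemma drv_eq f x a b : is_derive x 1 f a -> a = b -> is_derive x 1 f b.
Proof. by move=> fa <-. Qed.

Lemma drv1 f x d : is_derive x 1 f d -> derive1 f x = d.
Proof. by move=> fd; rewrite derive1E derive_val. Qed.

Lemma drv_derivable f x d : is_derive x 1 f d -> derivable f x 1.
Proof. by case. Qed.

Lemma derivable_drv f x : derivable f x 1 -> is_derive x 1 f (derive1 f x).
Proof. by move=> fx; rewrite derive1E; exact: derivableP. Qed.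

Lemma drv_cts f x d : is_derive x 1 f d -> {for x, continuous f}.
Proof.
by move=> [fx _]; apply/differentiable_continuous/derivable1_diffP.
Qed.

Lemma near_itvP (P : R -> Prop) x :
  (\forall y \near x, P y) <->
  exists2 e, 0 < e & forall y, x - e < y -> y < x + e -> P y.
Proof.
split.
  move=> /nbhs_ballP[e /= e0 eP]; exists e => // y y1 y2; apply: eP.
  by rewrite /ball /= ltr_distlC y1.
move=> [e e0 eP]; apply/nbhs_ballP; exists e => //= y.
by rewrite /ball /= ltr_distlC => /andP[]; exact: eP.
Qed.

Lemma drv_near f g x d : (\forall y \near x, f y = g y) ->
  is_derive x 1 f d -> is_derive x 1 g d.
Proof. exact: near_eq_is_derive. Qed.

Lemma cts_neq0_near f x : {for x, continuous f} -> f x != 0 ->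
  \forall y \near x, f y != 0.
Proof. by move=> fx f0; exact: (cvgr_neq0 _ fx). Qed.

Lemma near_oo f x a b : {for x, continuous f} -> a < f x < b ->
  \forall y \near x, a < f y < b.
Proof.
move=> fx /andP[af fb]; near=> y; apply/andP; split; near: y.
  exact: cvgr_gt fx _ af.
exact: cvgr_lt fx _ fb.
Unshelve. all: by end_near. Qed.

Lemma near_oo_id x a b : a < x < b -> \forall y \near x, a < y < b.
Proof. by apply: (@near_oo id); exact: (drv_cts (drv_id x)). Qed.

Lemma near_oo_affine p c x a b : a < p * x + c < b ->
  \forall y \near x, a < p * y + c < b.
Proof.
apply: (@near_oo (fun y => p * y + c)); apply: (@drv_cts _ _ p).
apply: drv_eq (drvD (drvM (drv_cst p x) (drv_id x)) (drv_cst c x)) _.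
by rewrite mul0r add0r mulr1 addr0.
Qed.

Lemma cts_eq0_adherent f x : {for x, continuous f} ->
  (forall e, 0 < e -> exists y, [/\ x - e < y, y < x + e & f y = 0]) ->
  f x = 0.
Proof.
move=> fx H; apply/eqP/negPn/negP => /(cts_neq0_near fx)/near_itvP[e e0 eP].
by have [y [y1 y2 y0]] := H e e0; move: (eP y y1 y2); rewrite y0 eqxx.
Qed.

(** The two one-sided difference quotients of a differentiable function have
    the same limit, so vanishing on one side of [x] forces a zero
    derivative. *)
Lemma drv_eq0_right f x d e : is_derive x 1 f d -> 0 < e ->
  f x = 0 -> (forall y, x < y -> y < x + e -> f y = 0) -> d = 0.
Proof.
move=> /is_derive1_caratheodory[g [fg gc <-]] e0 fx0 f0.
apply: cts_eq0_adherent gc _ => e' e'0.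
pose m := Num.min e e'; have m0 : 0 < m by rewrite lt_min e0.
have me : m <= e by rewrite ge_min lexx.
have me' : m <= e' by rewrite ge_min lexx orbT.
exists (x + m / 2); split; [lra|lra|].
have := fg (x + m / 2); rewrite fx0 f0; [|lra|lra].
move=> /esym/eqP; rewrite subrr mulf_eq0 => /orP[/eqP//|].
by rewrite addrC addKr mulf_eq0 invr_eq0 pnatr_eq0 orbF gt_eqF.
Qed.

Lemma drv0_cst f s t :
  (forall x, s < x < t -> is_derive x 1 f 0) ->
  forall x y, s < x < t -> s < y < t -> f x = f y.
Proof.
move=> f0.
suff lem x y : s < x -> x < y -> y < t -> f x = f y.
  move=> x y /andP[sx xt] /andP[sy yt].
  by have [xy|yx|->//] := ltgtP x y; [exact: lem|apply/esym; exact: lem].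
move=> sx xy yt.
have [||c _] := @MVT R f (fun=> 0) x y xy.
- by move=> z; rewrite in_itv/= => /andP[z1 z2]; apply: f0; lra.
- apply: derivable_within_continuous => z; rewrite in_itv/= => /andP[z1 z2].
  by apply: drv_derivable (f0 _ _); lra.
- by rewrite mul0r => /eqP; rewrite subr_eq0 => /eqP.
Qed.

Lemma drv_neq0_inj f df s t :
  (forall x, s < x < t -> is_derive x 1 f (df x)) ->
  (forall x, s < x < t -> df x != 0) ->
  forall x y, s < x < t -> s < y < t -> x != y -> f x - f y != 0.
Proof.
move=> fd f0.
suff lem x y : s < x -> x < y -> y < t -> f x - f y != 0.
  move=> x y /andP[sx xt] /andP[sy yt].
  have [xy _|yx _|//] := ltgtP x y; first exact: lem.
  by rewrite subr_eq0 eq_sym -subr_eq0; exact: lem.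
move=> sx xy yt.
have [||c] := @MVT R f df x y xy.
- by move=> z; rewrite in_itv/= => /andP[z1 z2]; apply: fd; lra.
- apply: derivable_within_continuous => z; rewrite in_itv/= => /andP[z1 z2].
  by apply: drv_derivable (fd _ _); lra.
- rewrite in_itv/= => /andP[c1 c2] fxy; rewrite -opprB fxy oppr_eq0 mulf_neq0//.
    by apply: f0; lra.
  by rewrite subr_eq0 gt_eqF.
Qed.

End Analysis.

(** Computes the derivative of an explicit expression, leaving the
    nonvanishing of inverted subterms as goals. *)
Ltac drv := first
  [ eassumption
  | apply: drv_cst
  | apply: drv_id
  | lazymatch goal with
    | |- is_derive _ _ (fun y => - _) _ => eapply drvN; drv
    | |- is_derive _ _ (fun y => _ - _) _ => eapply drvB; drv
    | |- is_derive _ _ (fun y => _ + _) _ => eapply drvD; drv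
    | |- is_derive _ _ (fun y => _ * _) _ => eapply drvM; drv
    | |- is_derive _ _ (fun y => _^-1) _ => eapply drvV; [try eassumption|drv]
    | |- is_derive _ _ ( *%R ?a) _ =>
        eapply (@drvM _ (fun=> a) (fun y => y)); drv
    | |- is_derive _ _ ( +%R ?a) _ =>
        eapply (@drvD _ (fun=> a) (fun y => y)); drv
    | |- is_derive _ _ (fun y => ?f (@?u y)) _ =>
        eapply (@drv_comp _ f u); drv
    | _ => idtac
    end ].


(** Entering through [eapply drv_eq] keeps the class mechanism from picking a
    derivative of its own in place of the one that [drv] builds. *)
Ltac drv_as := eapply drv_eq; [drv|rewrite /=].

(** * Germs of finite differentiability *)

Section Smooth.
Context {R : realType}.
Implicit Types (f g df : R -> R) (x y a b c : R) (n : nat).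

(** A condition on germs, so that a formula for [f] may be differentiated on
    whatever neighbourhood of [x] it happens to hold. *)
Fixpoint smooth n f x : Prop :=
  if n is m.+1 then (\forall y \near x, derivable f y 1) /\
                    smooth m (derive1 f) x
  else True.

Lemma near_derive1 f g x : (\forall y \near x, f y = g y) ->
  \forall y \near x, derive1 f y = derive1 g y.
Proof.
move=> /near_join; apply: filterS => y fg.
by rewrite !derive1E; exact: near_eq_derive.
Qed.

Lemma smooth_germ n f g x : (\forall y \near x, f y = g y) ->
  smooth n f x -> smooth n g x.
Proof.
elim: n f g => [//|n IH] f g fg /= [fd fs]; split.
  move: (near_join fg) fd; apply: filterS2 => y fgy fy.
  exact: near_eq_derivable fgy fy.
by apply: IH fs; exact: near_derive1.
Qed.

Lemma smooth_pt n f x : smooth n.+1 f x -> is_derive x 1 f (derive1 f x).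
Proof. by move=> [/nbhs_singleton fx _]; exact: derivable_drv. Qed.

Lemma smooth_drv n f df x : (\forall y \near x, is_derive (y : R) 1 f (df y)) ->
  smooth n df x -> smooth n.+1 f x.
Proof.
move=> fdf dfn; split; first by apply: filterS fdf => y [].
by apply: smooth_germ dfn; apply: filterS fdf => y /drv1.
Qed.

Lemma smooth_near n f x : smooth n.+1 f x ->
  \forall y \near x, is_derive (y : R) 1 f (derive1 f y).
Proof. by move=> [fx _]; apply: filterS fx => y /derivable_drv. Qed.

Lemma smoothW n f x : smooth n.+1 f x -> smooth n f x.
Proof.
elim: n f => [//|n IH] f [fx f'x]; split => //; exact: IH.
Qed.

Lemma smooth_cst n c x : smooth n (fun=> c) x.
Proof.
elim: n c => [//|n IH] c; apply: smooth_drv (IH 0).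
by apply: (@nearW _ (nbhs x)) => y; exact: drv_cst.
Qed.

Lemma smoothD n f g x : smooth n f x -> smooth n g x ->
  smooth n (fun y => f y + g y) x.
Proof.
elim: n f g => [//|n IH] f g fs gs.
apply: smooth_drv (IH _ _ fs.2 gs.2).
by move: (smooth_near fs) (smooth_near gs); apply: filterS2 => y fy gy; drv.
Qed.

Lemma smoothN n f x : smooth n f x -> smooth n (fun y => - f y) x.
Proof.
elim: n f => [//|n IH] f fs; apply: smooth_drv (IH _ fs.2).
by move: (smooth_near fs); apply: filterS => y fy; drv.
Qed.

Lemma smoothB n f g x : smooth n f x -> smooth n g x ->
  smooth n (fun y => f y - g y) x.
Proof. by move=> fs gs; apply: smoothD fs (smoothN gs). Qed.

Lemma smoothM n f g x : smooth n f x -> smooth n g x ->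
  smooth n (fun y => f y * g y) x.
Proof.
elim: n f g => [//|n IH] f g fs gs.
apply: smooth_drv (smoothD (IH _ _ fs.2 (smoothW gs)) (IH _ _ (smoothW fs) gs.2)).
by move: (smooth_near fs) (smooth_near gs); apply: filterS2 => y fy gy; drv.
Qed.

Lemma smoothV n f x : f x != 0 -> smooth n f x ->
  smooth n (fun y => (f y)^-1) x.
Proof.
move=> f0; elim: n => [//|n IH] fs.
have fV := IH (smoothW fs).
apply: (smooth_drv (df := fun y => (- derive1 f y) * ((f y)^-1 * (f y)^-1))).
  have fc : {for x, continuous f} by apply: drv_cts (smooth_pt fs).
  move: (cts_neq0_near fc f0) (smooth_near fs); apply: filterS2 => y fy0 fy.
  by drv_as; rewrite expr2 invfM.
by apply: smoothM (smoothM fV fV); apply: smoothN; exact: fs.2.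
Qed.

Lemma smooth_affine n f a b x : smooth n f (a * x + b) ->
  smooth n (fun y => f (a * y + b)) x.
Proof.
elim: n f => [//|n IH] f fs.
apply: (smooth_drv (df := fun y => derive1 f (a * y + b) * a)).
  have abd : is_derive x 1 (fun y => a * y + b) a by drv_as; ring.
  have ab := drv_cts abd.
  apply: (@filterS _ (nbhs x) _ _ _ _ (ab _ (smooth_near fs))) => y /= fy.
  by drv_as; ring.
by apply: smoothM (IH _ fs.2) _; exact: smooth_cst.
Qed.

End Smooth.

(** * The equation on an interval where the curve is regular *)

(** The linear equation [f''' = c f'], whose solutions are the three families
    of the classification. *)
Definition ode3 {R : realType} (c s t : R) (f : R -> R) := forall x,
  s < x < t -> [/\ is_derive x 1 f (derive1 f x),
    is_derive x 1 (derive1 f) (derive1 (derive1 f) x) &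
    is_derive x 1 (derive1 (derive1 f)) (c * derive1 f x)].

Lemma drv_mirror {R : realType} (w e : R) (a b da db : R -> R) :
  (forall x, w - e < x < w + e -> is_derive x 1 a (da x)) ->
  (forall x, w - e < x < w + e -> is_derive x 1 b (db x)) ->
  (forall x, - e < x < e -> a (w + x) = b (w - x)) ->
  forall x, - e < x < e -> da (w + x) = - db (w - x).
Proof.
move=> aD bD ab x xe.
have ax : is_derive (w + x) 1 a (da (w + x)) by apply: aD; lra.
have bx : is_derive (w - x) 1 b (db (w - x)) by apply: bD; lra.
have H1 : is_derive x 1 (fun y => a (w + y)) (da (w + x)) by drv_as; ring.
have H2 : is_derive x 1 (fun y => b (w - y)) (- db (w - x)) by drv_as; ring.
rewrite -(drv1 H1); apply: drv1; apply: drv_near H2.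
by have := near_oo_id xe; apply: filterS => y /ab.
Qed.

Lemma drv_subZ {R : realType} (f g : R -> R) (k x a b : R) :
  is_derive x 1 f a -> is_derive x 1 g b ->
  is_derive x 1 (fun y => f y - k * g y) (a - k * b).
Proof. by move=> fa gb; drv_as; ring. Qed.

(** Each differentiation turns symmetry about [w] into antisymmetry and back,
    and an antisymmetric function vanishes at [w]. *)
Lemma drv3_mirror {R : realType} (w e : R) (r r1 r2 r3 : R -> R) : 0 < e ->
  (forall x, w - e < x < w + e -> is_derive x 1 r (r1 x)) ->
  (forall x, w - e < x < w + e -> is_derive x 1 r1 (r2 x)) ->
  (forall x, w - e < x < w + e -> is_derive x 1 r2 (r3 x)) ->
  (forall x, 0 < x -> x < e -> r (w + x) = r (w - x)) ->
  [/\ forall x, - e < x < e -> r1 (w + x) = - r1 (w - x),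
      forall x, - e < x < e -> r3 (w + x) = - r3 (w - x) &
      r3 w = 0].
Proof.
move=> e0 r1D r2D r3D r0.
have rE x : - e < x < e -> r (w + x) = r (w - x).
  move=> /andP[x1 x2]; have [x0|x0|->] := ltgtP x 0; last by rewrite subr0 addr0.
    by have := r0 (- x); rewrite opprK => ->//; lra.
  exact: r0.
have r1E := drv_mirror r1D r1D rE.
have r1N x : w - e < x < w + e -> is_derive x 1 (fun y => - r1 y) (- r2 x).
  by move=> /r2D ?; drv_as.
have r2E x : - e < x < e -> r2 (w + x) = r2 (w - x).
  by move=> xe; rewrite (drv_mirror r2D r1N r1E xe) opprK.
have r3E := drv_mirror r3D r3D r2E.
split=> //.
have := r3E 0; rewrite addr0 subr0 => E.
have {}E : r3 w = - r3 w by apply: E; lra.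
lra.
Qed.

(** The defect [f - K w * g] is symmetric about [w], so the third
    derivatives of [f] and [g] obey the same chord relation as the first ones;
    hence the ratio of the third to the first derivative of [g] takes the same
    value at the two ends of every chord. *)
Lemma third_derivative_ratio {R : realType} (s t : R)
    (K f f1 f2 f3 g g1 g2 g3 : R -> R) : s < t ->
  (forall x, s < x < t -> is_derive x 1 f (f1 x)) ->
  (forall x, s < x < t -> is_derive x 1 f1 (f2 x)) ->
  (forall x, s < x < t -> is_derive x 1 f2 (f3 x)) ->
  (forall x, s < x < t -> is_derive x 1 g (g1 x)) ->
  (forall x, s < x < t -> is_derive x 1 g1 (g2 x)) ->
  (forall x, s < x < t -> is_derive x 1 g2 (g3 x)) ->
  (forall u v, s < u -> u < v -> v < t ->
    f v - f u = K ((u + v) / 2) * (g v - g u)) ->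
  (forall x, s < x < t -> f1 x = K x * g1 x) ->
  (forall x, s < x < t -> g1 x != 0) ->
  (forall x y, s < x < t -> s < y < t -> x != y -> K x - K y != 0) ->
  exists c, forall x, s < x < t -> f3 x = c * f1 x /\ g3 x = c * g1 x.
Proof.
move=> lt_st fD f2D f3D gD g2D g3D chord f1E g1n0 K_inj.
have sym w e : 0 < e -> s < w - e -> w + e < t ->
    [/\ f1 (w + e) - K w * g1 (w + e) = - (f1 (w - e) - K w * g1 (w - e)),
        f3 (w + e) - K w * g3 (w + e) = - (f3 (w - e) - K w * g3 (w - e)) &
        f3 w - K w * g3 w = 0].
  move=> e0 sw wt; pose e' := Num.min (w - s) (t - w).
  have ee' : e < e' by rewrite lt_min; lra.
  have e's : e' <= w - s by rewrite ge_min lexx.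
  have e't : e' <= t - w by rewrite ge_min lexx orbT.
  have in_st x : w - e' < x < w + e' -> s < x < t by lra.
  have ee : - e' < e < e' by lra.
  have [||||x x0 xe|r1 r3 r30] := @drv3_mirror _ w e' (fun x => f x - K w * g x)
    (fun x => f1 x - K w * g1 x) (fun x => f2 x - K w * g2 x)
    (fun x => f3 x - K w * g3 x).
  - by lra.
  - by move=> x /in_st xI; apply: drv_subZ; [exact: fD|exact: gD].
  - by move=> x /in_st xI; apply: drv_subZ; [exact: f2D|exact: g2D].
  - by move=> x /in_st xI; apply: drv_subZ; [exact: f3D|exact: g3D].
  - have [h1 h2 h3] : [/\ s < w - x, w - x < w + x & w + x < t] by split; lra.
    have := chord _ _ h1 h2 h3; rewrite (_ : _ / 2 = w); last by field.
    move=> E; rewrite (_ : f (w + x) = f (w - x) + K w * (g (w + x) - g (w - x))).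
      by ring.
    by rewrite -E; ring.
  - by split; [exact: r1|exact: r3|].
have f3E x : s < x < t -> f3 x = K x * g3 x.
  move=> sxt; pose m := Num.min (x - s) (t - x); pose e := m / 2.
  have m0 : 0 < m by rewrite lt_min; lra.
  have e's : m <= x - s by rewrite ge_min lexx.
  have e't : m <= t - x by rewrite ge_min lexx orbT.
  have e0 : 0 < e by rewrite /e; lra.
  have se : s < x - e by rewrite /e; lra.
  have te : x + e < t by rewrite /e; lra.
  by have [_ _ /eqP] := sym x e e0 se te; rewrite subr_eq0 => /eqP.
have ratio u v : s < u -> u < v -> v < t -> g3 v * g1 u = g3 u * g1 v.
  move=> su uv vt; pose w := (u + v) / 2; pose e := (v - u) / 2.
  have wu : w - e = u by rewrite /w /e; field.
  have wv : w + e = v by rewrite /w /e; field.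
  have e0 : 0 < e by rewrite /e; lra.
  have := sym w e e0; rewrite wu wv => /(_ su vt)[E1 E3 _].
  rewrite !f1E ?f3E in E1 E3; [|lra|lra|lra|lra].
  have A0 : K v - K w != 0 by apply: K_inj; rewrite /w; [lra|lra|rewrite gt_eqF//; lra].
  apply: (mulfI A0).
  have {}E1 : (K v - K w) * g1 v = - (K u - K w) * g1 u by rewrite mulrBl E1; ring.
  have {}E3 : (K v - K w) * g3 v = - (K u - K w) * g3 u by rewrite mulrBl E3; ring.
  by rewrite mulrA E3 [RHS]mulrCA E1; ring.
pose m := (s + t) / 2.
have smt : s < m < t by rewrite /m; lra.
pose c := g3 m / g1 m.
have g3E x : s < x < t -> g3 x = c * g1 x.
  move=> sxt; have gm0 := g1n0 _ smt.
  apply: (mulIf gm0); rewrite /c mulrAC divfK//.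
  have [xm|mx|->//] := ltgtP x m.
    by apply/esym/ratio; lra.
  by apply: ratio; lra.
exists c => x sxt; split; last exact: g3E.
by rewrite f3E// g3E// f1E//; ring.
Qed.

Section Regular.
Context {R : realType}.
Variables (al be : R) (s t : R) (f g : R -> R).
Hypotheses (al0 : 0 < al) (be0 : 0 < be) (albe : al + be = 1) (st : s < t).
Hypothesis fd : forall x, s < x < t -> derivable f x 1.
Hypothesis gd : forall x, s < x < t -> derivable g x 1.
Hypothesis g1n0 : forall x, s < x < t -> derive1 g x != 0.
Hypothesis parallel : forall u v u' v', s < u -> u < v -> v < t ->
  s < u' -> u' < v' -> v' < t -> al * u + be * v = al * u' + be * v' ->
  (f v - f u) * (g v' - g u') = (g v - g u) * (f v' - f u').
Hypothesis not_line : forall s' t' k, s <= s' -> s' < t' -> t' <= t ->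
  ~ (forall x y, s' < x < t' -> s' < y < t' -> f x - k * g x = f y - k * g y).

Let f1 : R -> R := derive1 f.
Let g1 : R -> R := derive1 g.
Let K (x : R) : R := f1 x / g1 x.

Let alE : al = 1 - be. Proof. by rewrite -albe addrK. Qed.

Let fD x : s < x < t -> is_derive x 1 f (f1 x).
Proof. by move=> sxt; apply: derivable_drv; exact: fd. Qed.

Let gD x : s < x < t -> is_derive x 1 g (g1 x).
Proof. by move=> sxt; apply: derivable_drv; exact: gd. Qed.

Let g_inj x y : s < x < t -> s < y < t -> x != y -> g x - g y != 0.
Proof. exact: (drv_neq0_inj gD g1n0). Qed.

Let f1E x : s < x < t -> f1 x = K x * g1 x.
Proof. by move=> sxt; rewrite /K divfK//; exact: g1n0. Qed.

Let mix u v : u < v -> u < al * u + be * v < v.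
Proof.
move=> uv; have p : 0 < be * (v - u) by rewrite mulr_gt0 ?subr_gt0.
have q : 0 < al * (v - u) by rewrite mulr_gt0 ?subr_gt0.
by rewrite alE in q *; lra.
Qed.

(** The chords over [w] are parallel to one another; as they shrink to [w],
    their common direction is seen to be that of the tangent. *)
Let chord u v : s < u -> u < v -> v < t ->
  f v - f u = K (al * u + be * v) * (g v - g u).
Proof.
move=> su uv vt; set w := al * u + be * v.
have /andP[uw wv] : u < w < v by exact: mix.
have gw0 : g1 w != 0 by apply: g1n0; lra.
have fw : is_derive w 1 f (f1 w) by apply: fD; lra.
have gw : is_derive w 1 g (g1 w) by apply: gD; lra.
have wa : w + al * 0 = w by ring.
have wb : w - be * 0 = w by ring.
pose phi (x : R) : R := (f (w + al * x) - f (w - be * x)) * (g v - g u) -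
              (g (w + al * x) - g (w - be * x)) * (f v - f u).
have phi0 : is_derive (0 : R) 1 phi (f1 w * (g v - g u) - g1 w * (f v - f u)).
  rewrite /phi; drv_as; rewrite ?wa ?wb; try eassumption.
  by rewrite alE; ring.
have : f1 w * (g v - g u) - g1 w * (f v - f u) = 0.
  apply: (drv_eq0_right phi0 (e := v - u)); first by rewrite subr_gt0.
    by rewrite /phi wa wb !subrr !mul0r subrr.
  move=> x x0 xe; rewrite /phi; apply/eqP; rewrite subr_eq0; apply/eqP.
  have vE : v = w + al * (v - u) by rewrite /w alE; ring.
  have uE : u = w - be * (v - u) by rewrite /w alE; ring.
  have px : 0 < al * ((v - u) - x) by rewrite mulr_gt0// subr_gt0; lra.
  have qx : 0 < be * ((v - u) - x) by rewrite mulr_gt0// subr_gt0; lra.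
  have px0 : 0 < al * x by rewrite mulr_gt0.
  have qx0 : 0 < be * x by rewrite mulr_gt0.
  apply: parallel => //; [lra|lra|lra|].
  by rewrite -/w alE; ring.
move=> /eqP; rewrite subr_eq0 => /eqP E.
apply: (mulfI gw0); rewrite -E /K; field.
exact: gw0.
Qed.

Let fiber w : s < w < t -> exists u v,
  [/\ s < u, u < w, w < v, v < t & w = al * u + be * v].
Proof.
move=> /andP[sw wt]; pose m := Num.min (w - s) (t - w).
have m0 : 0 < m by rewrite lt_min !subr_gt0 sw.
have ms : m <= w - s by rewrite ge_min lexx.
have mt : m <= t - w by rewrite ge_min lexx orbT.
have pm : 0 < al * m by rewrite mulr_gt0.
have qm : 0 < be * m by rewrite mulr_gt0.
have abm : al * m + be * m = m by rewrite -mulrDl albe mul1r.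
exists (w - be * m), (w + al * m); split; [lra|lra|lra|lra|].
by rewrite alE; ring.
Qed.

Let K1 : R -> R := derive1 K.

(** [K] inherits the regularity of [f] and [g] through the chord formula with
    one endpoint held fixed. *)
Let near_K w u v : s < u -> u < w -> w < v -> v < t -> w = al * u + be * v ->
  \forall x \near w, (f (be^-1 * x + - (al / be * u)) - f u) /
    (g (be^-1 * x + - (al / be * u)) - g u) = K x.
Proof.
move=> su uw wv vt wE; have ben0 : be != 0 by rewrite gt_eqF.
apply/near_itvP; exists (Num.min (w - u) (be * (t - v))).
  by rewrite lt_min subr_gt0 uw mulr_gt0 ?subr_gt0.
set m := Num.min _ _ => x x1 x2.
have mu : m <= w - u by rewrite ge_min lexx.
have mv : m <= be * (t - v) by rewrite ge_min lexx orbT.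
pose v' := be^-1 * x + - (al / be * u); rewrite -/v'.
have v'E : be * v' = x - al * u by rewrite /v'; field.
have uv' : u < v'.
  have : 0 < be * (v' - u) by rewrite mulrBr v'E alE; lra.
  by rewrite pmulr_rgt0// subr_gt0.
have v't : v' < t.
  have : 0 < be * (t - v') by rewrite mulrBr v'E; lra.
  by rewrite pmulr_rgt0// subr_gt0.
rewrite chord// v'E [al * u + _]addrC subrK mulfK//.
by apply: g_inj; [lra|lra|rewrite gt_eqF].
Qed.

Let vofw w u v : w = al * u + be * v -> be^-1 * w + - (al / be * u) = v.
Proof. by move=> ->; field; rewrite gt_eqF. Qed.

Let uofw w u v : w = al * u + be * v -> al^-1 * w + - (be / al * v) = u.
Proof. by move=> ->; field; rewrite gt_eqF. Qed.

Let KD w : s < w < t -> is_derive w 1 K (K1 w).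
Proof.
move=> swt; have [u [v [su uw wv vt wE]]] := fiber swt.
apply: derivable_drv; apply: near_eq_derivable (near_K su uw wv vt wE) _.
have fv : is_derive v 1 f (f1 v) by apply: fD; lra.
have gv : is_derive v 1 g (g1 v) by apply: gD; lra.
eapply drv_derivable; drv; rewrite ?(vofw wE); try eassumption.
by apply: g_inj; [lra|lra|rewrite gt_eqF//; lra].
Qed.

(** The derivatives of the chord formula with respect to one endpoint, the
    other being fixed. *)
Let chord_drv u v : s < u -> u < v -> v < t -> let w := al * u + be * v in
  (K v - K w) * g1 v = be * K1 w * (g v - g u) /\
  (K w - K u) * g1 u = al * K1 w * (g v - g u).
Proof.
move=> su uv vt w.
have /andP[uw wv] : u < w < v by exact: mix.
have fv : is_derive v 1 f (f1 v) by apply: fD; lra.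
have gv : is_derive v 1 g (g1 v) by apply: gD; lra.
have fu : is_derive u 1 f (f1 u) by apply: fD; lra.
have gu : is_derive u 1 g (g1 u) by apply: gD; lra.
have Kw : is_derive w 1 K (K1 w) by apply: KD; lra.
split.
- have H1 : is_derive v 1 (fun x => K (al * u + be * x) * (g x - g u))
      (K1 w * be * (g v - g u) + K w * g1 v) by drv_as; rewrite -/w; ring.
  have H2 : is_derive v 1 (fun x => f x - f u) (f1 v) by drv_as; ring.
  have H3 : is_derive v 1 (fun x => K (al * u + be * x) * (g x - g u)) (f1 v).
    apply: drv_near H2; apply/near_itvP; exists (Num.min (v - u) (t - v)).
      by rewrite lt_min !subr_gt0 uv.
    set m := Num.min _ _ => x x1 x2.
    have mu : m <= v - u by rewrite ge_min lexx.
    have mv : m <= t - v by rewrite ge_min lexx orbT.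
    by apply: chord; lra.
  have := drv1 H1; rewrite (drv1 H3) f1E => [E|]; last lra.
  by rewrite mulrBl E; ring.
- have H1 : is_derive u 1 (fun x => K (al * x + be * v) * (g v - g x))
      (K1 w * al * (g v - g u) - K w * g1 u) by drv_as; rewrite -/w; ring.
  have H2 : is_derive u 1 (fun x => f v - f x) (- f1 u) by drv_as; ring.
  have H3 : is_derive u 1 (fun x => K (al * x + be * v) * (g v - g x)) (- f1 u).
    apply: drv_near H2; apply/near_itvP; exists (Num.min (u - s) (v - u)).
      by rewrite lt_min !subr_gt0 uv andbT.
    set m := Num.min _ _ => x x1 x2.
    have mu : m <= u - s by rewrite ge_min lexx.
    have mv : m <= v - u by rewrite ge_min lexx orbT.
    by apply: chord; lra.
  have := drv1 H1; rewrite (drv1 H3) f1E => [E|]; last lra.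
  by rewrite mulrBl -[K u * _]opprK E; ring.
Qed.

(** A zero of [K'] would make [K] constant, hence the curve straight, to its
    right. *)
Let K1n0 w : s < w < t -> K1 w != 0.
Proof.
move=> swt; have [u [v [su uw wv vt wE]]] := fiber swt.
apply/eqP => K10.
apply: (@not_line w v (K w)); [lra|lra|lra|].
apply: drv0_cst => x /andP[wx xv].
have fx : is_derive x 1 f (f1 x) by apply: fD; lra.
have gx : is_derive x 1 g (g1 x) by apply: gD; lra.
drv_as; rewrite f1E; last lra.
pose u' := al^-1 * w + - (be / al * x).
have wE' : w = al * u' + be * x by rewrite /u'; field; rewrite gt_eqF.
have uu' : u < u'.
  have : 0 < al * (u' - u).
    have -> : al * (u' - u) = be * (v - x) by rewrite mulrBr; lra.
    by rewrite mulr_gt0// subr_gt0.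
  by rewrite pmulr_rgt0// subr_gt0.
have u'w : u' < w.
  have : 0 < al * (w - u').
    have -> : al * (w - u') = be * (x - w) by rewrite mulrBr {1}alE; lra.
    by rewrite mulr_gt0// subr_gt0.
  by rewrite pmulr_rgt0// subr_gt0.
have [||| /eqP E _] := @chord_drv u' x; [lra|lra|lra|].
move: E; rewrite -wE' K10 mulr0 !mul0r mulf_eq0.
have /negPf -> : g1 x != 0 by apply: g1n0; lra.
rewrite orbF subr_eq0 => /eqP ->; ring.
Qed.

Let K_inj x y : s < x < t -> s < y < t -> x != y -> K x - K y != 0.
Proof. exact: (drv_neq0_inj KD K1n0). Qed.

(** With [v] fixed, the first formula of [chord_drv] expresses the derivative
    of [K] through [K] and [g]; with [u] fixed, it expresses that of [g] through
    [g], [K] and the derivative of [K]. So the regularity of the two functions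
    improves alternately. *)
Let smoothK n : (forall w, s < w < t -> smooth n.+1 K w /\ smooth n.+1 g w) ->
  forall w, s < w < t -> smooth n.+2 K w.
Proof.
move=> IH w swt; have [u [v [su uw wv vt wE]]] := fiber swt.
pose uu (x : R) : R := al^-1 * x + - (be / al * v).
pose df (x : R) : R := (K v - K x) * g1 v * (be * (g v - g (uu x)))^-1.
have uuw : uu w = u by exact: uofw.
apply: (smooth_drv (df := df)).
  have H1 : \forall x \near w, s < uu x < w.
    by apply: near_oo_affine; rewrite -/(uu w) uuw su.
  move: H1 (near_oo_id swt); apply: filterS2 => x /andP[x1 x2] sxt.
  have uux : uu x < v by lra.
  have xE : al * uu x + be * v = x by rewrite /uu; field; rewrite gt_eqF.
  have [||| E _] := @chord_drv (uu x) v; [lra|lra|lra|].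
  rewrite xE in E.
  have Kx : is_derive x 1 K (K1 x) by apply: KD; lra.
  have gux : g v - g (uu x) != 0 by apply: g_inj; [lra|lra|rewrite gt_eqF].
  by apply: drv_eq Kx _; rewrite /df E; field; rewrite gux gt_eqF.
have [sK sg] : smooth n.+1 K w /\ smooth n.+1 g u.
  by split; [apply: (IH w _).1|apply: (IH u _).2]; lra.
apply: smoothM (smoothM (smoothB (smooth_cst _ _ _) sK) (smooth_cst _ _ _)) _.
apply: smoothV.
  have guv : g v - g u != 0 by apply: g_inj; [lra|lra|rewrite gt_eqF//; lra].
  by rewrite uuw mulf_neq0// gt_eqF.
apply: smoothM; first exact: smooth_cst.
apply: smoothB; first exact: smooth_cst.
by apply: smooth_affine; rewrite -/(uu w) uuw.
Qed.

Let smoothg n : (forall w, s < w < t -> smooth n.+2 K w) ->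
  (forall w, s < w < t -> smooth n.+1 g w) ->
  forall v, s < v < t -> smooth n.+2 g v.
Proof.
move=> sK sg v svt; pose u := (s + v) / 2.
have su : s < u by rewrite /u; lra.
have uv : u < v by rewrite /u; lra.
pose ww (x : R) : R := be * x + al * u.
have wwE x : al * u + be * x = ww x by rewrite addrC.
pose df (x : R) : R := be * K1 (ww x) * (g x - g u) * (K x - K (ww x))^-1.
have ww_mix x : u < x -> u < ww x < x by move=> ux; rewrite -wwE; exact: mix.
have /andP[w1 w2] := ww_mix v uv.
apply: (smooth_drv (df := df)).
  have uvt : u < v < t by lra.
  have := near_oo_id uvt; apply: filterS => x /andP[x1 x2].
  have gx : is_derive x 1 g (g1 x) by apply: gD; lra.
  have /andP[x3 x4] := ww_mix x x1.
  apply: drv_eq gx _; have [||| E _] := @chord_drv u x; [lra|lra|lra|].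
  rewrite wwE in E; rewrite /df -E; field.
  by apply: K_inj; [lra|lra|rewrite gt_eqF//; lra].
have swt : s < ww v < t by lra.
apply: smoothM; first apply: smoothM; first apply: smoothM.
- exact: smooth_cst.
- by apply: smooth_affine; exact: (sK _ swt).2.
- by apply: smoothB; [exact: sg|exact: smooth_cst].
- apply: smoothV; first by apply: K_inj; [lra|lra|rewrite gt_eqF//; lra].
  apply: smoothB; first exact: smoothW (sK _ svt).
  by apply: smooth_affine; exact: smoothW (sK _ swt).
Qed.

Let smoothKg n w : s < w < t -> smooth n.+1 K w /\ smooth n.+1 g w.
Proof.
elim: n w => [|n IH] w swt.
  have near_in := near_oo_id swt.
  split; [apply: (smooth_drv (df := K1))|apply: (smooth_drv (df := g1))] => //.
    by move: near_in; apply: filterS => x; exact: KD.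
  by move: near_in; apply: filterS => x; exact: gD.
have sK := smoothK IH; split; first exact: sK.
by apply: smoothg => // x /IH[].
Qed.

Let smoothf n v : s < v < t -> smooth n f v.
Proof.
move=> svt; pose u := (s + v) / 2.
have su : s < u by rewrite /u; lra.
have uvt : u < v < t by rewrite /u; lra.
have /andP[w1 w2] : u < al * u + be * v < v by apply: mix; lra.
have swt : s < be * v + al * u < t by rewrite [be * v + _]addrC; lra.
apply: smoothW; apply: (@smooth_germ _ _ (fun x => f u + K (be * x + al * u) * (g x - g u))).
  have := near_oo_id uvt; apply: filterS => x /andP[x1 x2].
  by rewrite [be * x + _]addrC -chord//; lra.
apply: smoothD; first exact: smooth_cst.
apply: smoothM; first by apply: smooth_affine; exact: (smoothKg _ swt).1.
by apply: smoothB; [exact: (smoothKg _ svt).2|exact: smooth_cst].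
Qed.

(** Letting both endpoints of the chords over [w] tend to [w] compares the
    two weights. *)
Lemma regular_weights : al = be.
Proof.
pose w := (s + t) / 2; pose e := (t - s) / 2.
have lt_st := st.
have swt : s < w < t by rewrite /w; lra.
have e0 : 0 < e by rewrite /e; lra.
have sg2 := (smoothKg 1 swt).2.
have gw : is_derive w 1 g1 (derive1 g1 w) by exact: (@smooth_pt _ 0 _ _ sg2.2).
have Kw : is_derive w 1 K (K1 w) by exact: KD.
have wa : w + al * 0 = w by ring.
have wb : w - be * 0 = w by ring.
pose phi (x : R) : R := al * (K (w + al * x) - K w) * g1 (w + al * x) -
  be * (K w - K (w - be * x)) * g1 (w - be * x).
have phi0 : is_derive (0 : R) 1 phi ((al ^+ 2 - be ^+ 2) * (K1 w * g1 w)).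
  by rewrite /phi; drv_as; rewrite ?wa ?wb; try eassumption; ring.
have : (al ^+ 2 - be ^+ 2) * (K1 w * g1 w) = 0.
  apply: (drv_eq0_right phi0 e0); first by rewrite /phi wa wb !subrr !mulr0 !mul0r subrr.
  move=> x x0; rewrite add0r => xe; rewrite /phi.
  have px : 0 < al * x by rewrite mulr_gt0.
  have qx : 0 < be * x by rewrite mulr_gt0.
  have pq : al * x + be * x = x by rewrite -mulrDl albe mul1r.
  have sw : s < w - be * x.
    by rewrite (_ : s = w - e); [lra|rewrite /w /e; lra].
  have wt : w + al * x < t.
    by rewrite (_ : t = w + e); [lra|rewrite /w /e; lra].
  have ww : w - be * x < w + al * x by lra.
  have [] := chord_drv sw ww wt.
  rewrite (_ : al * _ + be * _ = w); last by rewrite alE /w; ring.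
  rewrite -/w => E1 E2.
  by rewrite -!mulrA E1 E2; ring.
move=> /eqP; rewrite mulf_eq0 mulf_eq0.
rewrite (negPf (K1n0 swt)) (negPf (g1n0 swt)) !orbF subr_sqr albe mulr1 subr_eq0.
by move=> /eqP.
Qed.


Let ode_of_smooth c h :
  (forall x, s < x < t -> smooth 3 h x) ->
  (forall x, s < x < t -> derive1 (derive1 (derive1 h)) x = c * derive1 h x) ->
  ode3 c s t h.
Proof.
move=> sh hc x sxt; have [h0 [h1 [h2 _]]] := sh x sxt.
split; first exact: derivable_drv (nbhs_singleton h0).
  exact: derivable_drv (nbhs_singleton h1).
exact: drv_eq (derivable_drv (nbhs_singleton h2)) (hc x sxt).
Qed.

Lemma regular_ode : exists c, ode3 c s t f /\ ode3 c s t g.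
Proof.
have beh : be = 2^-1 by have := regular_weights; rewrite alE => ?; lra.
have alh : al = 2^-1 by rewrite -beh; exact: regular_weights.
have f2D x : s < x < t -> is_derive x 1 f1 (derive1 f1 x).
  by move=> sxt; exact: (@smooth_pt _ 1 _ _ (smoothf 3 sxt).2).
have f3D x : s < x < t -> is_derive x 1 (derive1 f1) (derive1 (derive1 f1) x).
  by move=> sxt; exact: (@smooth_pt _ 0 _ _ (smoothf 3 sxt).2.2).
have g2D x : s < x < t -> is_derive x 1 g1 (derive1 g1 x).
  by move=> sxt; exact: (@smooth_pt _ 1 _ _ (smoothKg 2 sxt).2.2).
have g3D x : s < x < t -> is_derive x 1 (derive1 g1) (derive1 (derive1 g1) x).
  by move=> sxt; exact: (@smooth_pt _ 0 _ _ (smoothKg 2 sxt).2.2.2).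
have mid u v : s < u -> u < v -> v < t ->
    f v - f u = K ((u + v) / 2) * (g v - g u).
  by move=> su uv vt; rewrite chord// alh beh; congr (K _ * _); ring.
have [c cP] :=
  third_derivative_ratio st fD f2D f3D gD g2D g3D mid f1E g1n0 K_inj.
exists c; split; apply: ode_of_smooth => x sxt.
- exact: smoothf.
- by have [] := cP x sxt.
- exact: (smoothKg 2 sxt).2.
- by have [] := cP x sxt.
Qed.

End Regular.

(** * Curves with a prescribed tangent *)

Section Curves.
Context {R : realType}.
Implicit Types (J : set R) (k f g F G q Q : R -> R) (a b al be s t u v w x y : R).

(** [Q] is the derivative of [q] with respect to another parameter, whose
    speed relative to the present one is [k]; the speed may vanish, and then
    [q] need not be differentiable. *)
Record velocity J k q Q : Prop := Velocity {
  vel_cts : forall w, J w -> {for w, continuous q};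
  vel_der : forall w, J w -> k w != 0 -> derivable q w 1;
  vel_chain : forall w d, J w -> is_derive w 1 q d -> Q w = d * k w;
  vel_flat : forall x y, x < y -> J x -> J y ->
    (forall w, x < w < y -> Q w = 0) -> q x = q y }.

(** The plane curve [(f, g)] has at each point the tangent direction [(F, G)],
    possibly zero, and every chord is parallel to the tangent at the weighted
    mean of its endpoints, hereafter called a chord over that mean. The field
    [cv_vel] speaks of all linear combinations because one of them may be
    differentiable where neither [f] nor [g] is. *)
Record curve J k al be f g F G : Prop := Curve {
  cv_itv : forall x y z, J x -> J z -> x <= y <= z -> J y;
  cv_open : forall x, J x -> \forall y \near x, J y;
  cv_al : 0 < al;
  cv_be : 0 < be;
  cv_albe : al + be = 1;
  cv_dense : forall x y, x < y -> J x -> J y -> exists2 w, x < w < y & k w != 0;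
  cv_vel : forall a b,
    velocity J k (fun x => a * f x + b * g x) (fun x => a * F x + b * G x);
  cv_eq : forall u v, J u -> J v -> u < v ->
    (f v - f u) * G (al * u + be * v) = (g v - g u) * F (al * u + be * v) }.

Lemma velocity_reflect J k q Q : velocity J k q Q ->
  velocity (fun x => J (- x)) (fun x => k (- x)) (fun x => q (- x))
    (fun x => - Q (- x)).
Proof.
have oppK (p : R -> R) x d : is_derive x 1 (fun y => p (- y)) d ->
    is_derive (- x) 1 p (- d).
  move=> pd; have pd' : is_derive (- - x) 1 (fun y => p (- y)) d by rewrite opprK.
  have H : is_derive (- x) 1 (fun y => p (- - y)) (- d).
    apply: drv_eq (@drv_comp _ (fun y => p (- y)) _ _ _ _ pd' (drvN (drv_id (- x)))) _.
    by ring.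
  by rewrite (_ : p = fun y => p (- - y))//; apply/funext => y; rewrite opprK.
case=> qc qd qch qf; split.
- move=> w Jw; apply: (@continuous_comp _ _ _ -%R q); last exact: qc.
  by apply: drv_cts (drvN (drv_id w)).
- move=> w Jw kw; have /derivable_drv qw := qd _ Jw kw.
  by eapply drv_derivable; drv.
- by move=> w d Jw /oppK qw; rewrite (qch _ _ Jw qw); ring.
- move=> x y xy Jx Jy Q0; apply/esym; apply: qf => //; first lra.
  by move=> w wI; apply/eqP; rewrite -oppr_eq0 -[w]opprK; apply/eqP; apply: Q0; lra.
Qed.

Lemma curve_reflect J k al be f g F G : curve J k al be f g F G ->
  curve (fun x => J (- x)) (fun x => k (- x)) be al
    (fun x => f (- x)) (fun x => g (- x)) (fun x => - F (- x)) (fun x => - G (- x)).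
Proof.
case=> itvJ opJ al0 be0 albe dense vel eqn; split => //.
- by move=> x y z Jx Jz xyz; apply: (itvJ (- z) _ (- x)) => //; lra.
- move=> x Jx; have opp : {for x, continuous (fun y : R => - y)}.
    by apply: drv_cts (drvN (drv_id x)).
  exact: (@filterS _ (nbhs x) _ _ _ _ (opp _ (opJ _ Jx))).
- by rewrite addrC.
- move=> x y xy Jx Jy; have [|w wI kw] := dense (- y) (- x) _ Jy Jx; first lra.
  by exists (- w); [lra|rewrite opprK].
- move=> a b; have H := velocity_reflect (vel a b).
  rewrite (_ : (fun x => a * - F (- x) + b * - G (- x)) =
    fun x => - (a * F (- x) + b * G (- x)))//.
  by apply/funext => x; ring.
- move=> u v Ju Jv uv; have := eqn (- v) (- u) Jv Ju.
  rewrite (_ : al * - v + be * - u = - (be * u + al * v)); last by ring.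
  have vu : - v < - u by lra.
  by move=> /(_ vu) E; rewrite !mulrN -!mulNr !opprB.
Qed.

Lemma curve_lin J k al be f g F G a b c d : curve J k al be f g F G ->
  curve J k al be (fun x => a * f x + b * g x) (fun x => c * f x + d * g x)
    (fun x => a * F x + b * G x) (fun x => c * F x + d * G x).
Proof.
case=> itvJ opJ al0 be0 albe dense vel eqn; split => //.
- move=> p q; have := vel (p * a + q * c) (p * b + q * d).
  rewrite (_ : (fun x => _ * f x + _) =
    (fun x => p * (a * f x + b * g x) + q * (c * f x + d * g x))); last first.
    by apply/funext => x; ring.
  rewrite (_ : (fun x => _ * F x + _) =
    (fun x => p * (a * F x + b * G x) + q * (c * F x + d * G x)))//.
  by apply/funext => x; ring.
- move=> u v Ju Jv uv; have /eqP := eqn u v Ju Jv uv.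
  rewrite -subr_eq0 => /eqP E; apply/eqP; rewrite -subr_eq0; apply/eqP.
  set w := al * u + be * v in E *.
  transitivity ((a * d - b * c) * ((f v - f u) * G w - (g v - g u) * F w)).
    by ring.
  by rewrite E mulr0.
Qed.

Lemma curve_swap J k al be f g F G : curve J k al be f g F G ->
  curve J k al be g f G F.
Proof.
move=> /(curve_lin 0 1 1 0).
have H (p q : R -> R) : (fun x => 0 * p x + 1 * q x) = q.
  by apply/funext => x; ring.
have H' (p q : R -> R) : (fun x => 1 * p x + 0 * q x) = p.
  by apply/funext => x; ring.
by rewrite !H !H'.
Qed.

Lemma curve_vel1 J k al be f g F G : curve J k al be f g F G -> velocity J k f F.
Proof.
move=> /cv_vel/(_ 1 0).
have H (p q : R -> R) : (fun x => 1 * p x + 0 * q x) = p.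
  by apply/funext => x; ring.
by rewrite !H.
Qed.

Lemma curve_vel2 J k al be f g F G : curve J k al be f g F G -> velocity J k g G.
Proof. by move=> /curve_swap/curve_vel1. Qed.

End Curves.

Section CurveTheory.
Context {R : realType}.
Variables (J : set R) (k : R -> R) (al be : R) (f g F G : R -> R).
Hypothesis cv : curve J k al be f g F G.
Implicit Types (a b s t u v w x y e : R).

Definition active w := J w /\ (F w != 0 \/ G w != 0).

Definition active_limit w := forall e, 0 < e ->
  exists w', [/\ w - e < w', w' < w + e & active w'].

Lemma idle_cst s t : (forall w, s < w < t -> ~ active w) ->
  forall x y, s <= x <= t -> s <= y <= t -> J x -> J y -> f x = f y /\ g x = g y.
Proof.
move=> idle.
suff lem x y : x < y -> s <= x -> y <= t -> J x -> J y -> f x = f y /\ g x = g y.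
  move=> x y xI yI Jx Jy; have [xy|yx|->//] := ltgtP x y.
    by apply: lem => //; lra.
  by have [-> ->] : f y = f x /\ g y = g x by apply: lem => //; lra.
move=> xy sx yt Jx Jy.
have FG w : x < w < y -> F w = 0 /\ G w = 0.
  move=> wI; have Jw : J w by apply: (cv_itv cv) Jx Jy _; lra.
  have /not_andP[//|/not_orP[/negP/negPn/eqP ? /negP/negPn/eqP ?]] : ~ active w.
    by apply: idle; lra.
  by [].
split.
  by apply: (vel_flat (curve_vel1 cv)) => // w /FG[].
by apply: (vel_flat (curve_vel2 cv)) => // w /FG[].
Qed.

(** Nearby active points see nearby chords parallel to their tangents; by
    continuity any two chords over a limit of active points are parallel. *)
Lemma fiber_parallel w : J w -> active_limit w ->
  forall u v u' v', J u -> J v -> J u' -> J v' -> u < v -> u' < v' ->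
  al * u + be * v = w -> al * u' + be * v' = w ->
  (f v - f u) * (g v' - g u') = (g v - g u) * (f v' - f u').
Proof.
move=> Jw lim u v u' v' Ju Jv Ju' Jv' uv uv' wE wE'.
pose phi (x : R) : R := (f (v + x) - f (u + x)) * (g (v' + x) - g (u' + x)) -
  (g (v + x) - g (u + x)) * (f (v' + x) - f (u' + x)).
suff : phi 0 = 0 by rewrite /phi !addr0 => /eqP; rewrite subr_eq0 => /eqP.
have shift_cts y : {for (0 : R), continuous (fun x => y + x)}.
  by apply: (@drv_cts _ _ _ (0 + 1)); exact: drvD (drv_cst _ _) (drv_id _).
have fc y : J y -> {for (0 : R), continuous (fun x => f (y + x))}.
  move=> Jy; apply: (@continuous_comp _ _ _ (fun x => y + x) f) => //=.
  by rewrite addr0; exact: (vel_cts (curve_vel1 cv)).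
have gc y : J y -> {for (0 : R), continuous (fun x => g (y + x))}.
  move=> Jy; apply: (@continuous_comp _ _ _ (fun x => y + x) g) => //=.
  by rewrite addr0; exact: (vel_cts (curve_vel2 cv)).
have near_J y : J y -> \forall x \near (0 : R), J (y + x).
  by move=> Jy; apply: (shift_cts y); rewrite /= addr0; exact: (cv_open cv).
have phic : {for (0 : R), continuous phi}.
  by apply: continuousB; apply: continuousM; apply: continuousB;
    first [exact: fc|exact: gc].
apply: (cts_eq0_adherent phic) => e e0.
have /near_itvP[e' e'0 Je'] : \forall x \near (0 : R),
    [/\ J (u + x), J (v + x), J (u' + x) & J (v' + x)].
  near=> x; split; near: x; exact: near_J.
pose m := Num.min e e'.
have m0 : 0 < m by rewrite lt_min e0.
have me : m <= e by rewrite ge_min lexx.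
have me' : m <= e' by rewrite ge_min lexx orbT.
have [w' [w1 w2 [Jw' act]]] := lim m m0.
have [Ju1 Jv1 Ju1' Jv1'] : [/\ J (u + (w' - w)), J (v + (w' - w)),
    J (u' + (w' - w)) & J (v' + (w' - w))] by apply: Je'; lra.
exists (w' - w); split; [lra|lra|].
have comb y z : al * y + be * z = w -> al * (y + (w' - w)) + be * (z + (w' - w)) = w'.
  move=> yz; transitivity (al * y + be * z + (al + be) * (w' - w)); first by ring.
  by rewrite yz (cv_albe cv); ring.
have lt1 : u + (w' - w) < v + (w' - w) by lra.
have lt2 : u' + (w' - w) < v' + (w' - w) by lra.
have /eqP := cv_eq cv Ju1 Jv1 lt1; rewrite comb// -subr_eq0 => /eqP E.
have /eqP := cv_eq cv Ju1' Jv1' lt2; rewrite comb// -subr_eq0 => /eqP E'.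
rewrite /phi.
set a := f (v + _) - _ in E *; set b := g (v + _) - _ in E *.
set a' := f (v' + _) - _ in E' *; set b' := g (v' + _) - _ in E' *.
case: act => [F0|G0].
  apply: (mulIf F0); rewrite mul0r.
  transitivity (a' * (a * G w' - b * F w') - a * (a' * G w' - b' * F w')).
    by ring.
  by rewrite E E' !mulr0 subrr.
apply: (mulIf G0); rewrite mul0r.
transitivity (b' * (a * G w' - b * F w') - b * (a' * G w' - b' * F w')).
  by ring.
by rewrite E E' !mulr0 subrr.
Unshelve. all: by end_near. Qed.

(** If the curve moves along a line around an active point [w], the tangent
    at [w] has the direction of that line, and so have all chords over [w],
    however long. *)
Lemma line_step a b s t : (a != 0 \/ b != 0) ->
  (forall x y, s < x < t -> s < y < t -> J x -> J y ->
     a * f x + b * g x = a * f y + b * g y) ->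
  forall w, s < w < t -> active w ->
  forall u v, J u -> J v -> u < v -> al * u + be * v = w ->
  a * f u + b * g u = a * f v + b * g v.
Proof.
move=> ab0 line w wI [Jw act] u v Ju Jv uv wE.
have Q0 : a * F w + b * G w = 0.
  rewrite -[RHS](mul0r (k w)); apply: (vel_chain (cv_vel cv a b) Jw).
  have := drv_cst (a * f w + b * g w) w; apply: drv_near.
  near=> x; apply: line => //.
    by near: x; exact: near_oo_id.
  by near: x; exact: (cv_open cv).
have := cv_eq cv Ju Jv uv; rewrite wE => E.
apply/eqP; rewrite -subr_eq0; apply/eqP.
have {}E : (f v - f u) * G w - (g v - g u) * F w = 0 by rewrite E subrr.
case: act => [F0|G0].
  apply: (mulIf F0); rewrite mul0r.
  transitivity (- (f v - f u) * (a * F w + b * G w) +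
    b * ((f v - f u) * G w - (g v - g u) * F w)); first by ring.
  by rewrite Q0 E !mulr0 addr0.
apply: (mulIf G0); rewrite mul0r.
transitivity (- (g v - g u) * (a * F w + b * G w) -
  a * ((f v - f u) * G w - (g v - g u) * F w)); first by ring.
by rewrite Q0 E !mulr0 subr0.
Unshelve. all: by end_near. Qed.

End CurveTheory.

(** * The three families of solutions *)

Section Models.
Context {R : realType}.
Implicit Types (e f g : R -> R) (a b c s t w x y mu : R).

Inductive model : (R -> R) -> (R -> R) -> Prop :=
| QuadModel : model (fun x => x) (fun x => x ^+ 2)
| ExpModel mu : mu != 0 -> model (fun x => expR (mu * x)) (fun x => expR (- mu * x))
| TrigModel mu : mu != 0 -> model (fun x => sin (mu * x)) (fun x => cos (mu * x)).

(** The properties shared by the three families: chords are parallel to the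
    tangent at the midpoint, with a factor depending on the half-length only,
    and the curvature never vanishes. *)
Record midpoint_pair e1 e2 (d1 d2 dd1 dd2 : R -> R) : Prop := MidpointPair {
  mp_d1 : forall x, is_derive x 1 e1 (d1 x);
  mp_d2 : forall x, is_derive x 1 e2 (d2 x);
  mp_dd1 : forall x, is_derive x 1 d1 (dd1 x);
  mp_dd2 : forall x, is_derive x 1 d2 (dd2 x);
  mp_chord : forall x, exists l, forall w,
    e1 (w + x) - e1 (w - x) = l * d1 w /\ e2 (w + x) - e2 (w - x) = l * d2 w;
  mp_wronskian : forall x, d1 x * dd2 x - d2 x * dd1 x != 0 }.

Lemma drv_expM mu x : is_derive x 1 (fun y => expR (mu * y)) (mu * expR (mu * x)).
Proof.
have H : is_derive (mu * x) 1 expR (expR (mu * x)) by exact: is_derive_expR.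
by drv_as; ring.
Qed.

Lemma drv_sinM mu x : is_derive x 1 (fun y => sin (mu * y)) (mu * cos (mu * x)).
Proof.
have H : is_derive (mu * x) 1 sin (cos (mu * x)) by exact: is_derive_sin.
by drv_as; ring.
Qed.

Lemma drv_cosM mu x : is_derive x 1 (fun y => cos (mu * y)) (- mu * sin (mu * x)).
Proof.
have H : is_derive (mu * x) 1 cos (- sin (mu * x)) by exact: is_derive_cos.
by drv_as; ring.
Qed.

Lemma drvZ c f x a : is_derive x 1 f a -> is_derive x 1 (fun y => c * f y) (c * a).
Proof. by move=> fa; drv_as; ring. Qed.

Lemma model_midpoint e1 e2 : model e1 e2 ->
  exists d1 d2 dd1 dd2, midpoint_pair e1 e2 d1 d2 dd1 dd2.
Proof.
case=> [|mu mu0|mu mu0].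
- exists (fun=> 1), (fun x => 2 * x), (fun=> 0), (fun=> 2); split.
  + exact: drv_id.
  + by move=> x; rewrite (_ : (fun y => y ^+ 2) = fun y => y * y)//; drv_as; ring.
  + exact: drv_cst.
  + by move=> x; drv_as; ring.
  + by move=> x; exists (2 * x) => w; split; ring.
  + by move=> x; rewrite mul1r mulr0 subr0 pnatr_eq0.
- exists (fun x => mu * expR (mu * x)), (fun x => - mu * expR (- mu * x)),
    (fun x => mu * (mu * expR (mu * x))), (fun x => - mu * (- mu * expR (- mu * x))).
  split.
  + by move=> x; exact: drv_expM.
  + by move=> x; exact: drv_expM.
  + by move=> x; apply: drvZ; exact: drv_expM.
  + by move=> x; apply: drvZ; exact: drv_expM.
  + move=> x; exists ((expR (mu * x) - expR (- mu * x)) / mu) => w.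
    rewrite !mulrDr !expRD !mulrN !mulNr opprK.
    by split; field.
  + move=> x; rewrite !mulNr !expRN.
    have E0 : expR (mu * x) != 0 by rewrite gt_eqF ?expR_gt0.
    rewrite (_ : _ - _ = 2 * mu ^+ 3); last by field.
    by rewrite mulf_neq0 ?pnatr_eq0// expf_neq0.
- exists (fun x => mu * cos (mu * x)), (fun x => - mu * sin (mu * x)),
    (fun x => mu * (- mu * sin (mu * x))), (fun x => - mu * (mu * cos (mu * x))).
  split.
  + by move=> x; exact: drv_sinM.
  + by move=> x; exact: drv_cosM.
  + by move=> x; apply: drvZ; exact: drv_cosM.
  + by move=> x; apply: drvZ; exact: drv_sinM.
  + move=> x; exists (2 * sin (mu * x) / mu) => w.
    rewrite !mulrDr !mulrN !sinD !cosD cosN sinN.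
    by split; field.
  + move=> x; rewrite (_ : _ - _ =
      - (mu ^+ 3 * (cos (mu * x) ^+ 2 + sin (mu * x) ^+ 2))); last by ring.
    by rewrite cos2Dsin2 mulr1 oppr_eq0 expf_neq0.
Qed.

Lemma span_of_drv e1 e2 (d1 d2 f f1 : R -> R) a b s t : s < t ->
  (forall x, is_derive x 1 e1 (d1 x)) -> (forall x, is_derive x 1 e2 (d2 x)) ->
  (forall x, s < x < t -> is_derive x 1 f (f1 x)) ->
  (forall x, s < x < t -> f1 x = a * d1 x + b * d2 x) ->
  exists c, forall x, s < x < t -> f x = c + (a * e1 x + b * e2 x).
Proof.
move=> st e1D e2D fD f1E.
have D0 x : s < x < t -> is_derive x 1 (fun y => f y - (a * e1 y + b * e2 y)) 0.
  move=> xI; have := e1D x; have := e2D x; have := fD x xI => fx ex1 ex2.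
  by drv_as; rewrite f1E//; ring.
exists (f ((s + t) / 2) - (a * e1 ((s + t) / 2) + b * e2 ((s + t) / 2))) => x xI.
by rewrite (drv0_cst D0 (x := (s + t) / 2) (y := x)) ?subrK//; lra.
Qed.

Lemma cst_of_drv f s t : s < t -> (forall x, s < x < t -> is_derive x 1 f 0) ->
  exists c, forall x, s < x < t -> f x = c.
Proof.
move=> st f0; exists (f ((s + t) / 2)) => x xI.
by apply: (drv0_cst f0) => //; lra.
Qed.

(** In each case two first integrals [A] and [B] of the equation express the
    first derivative, and one more integration gives the function. *)
Lemma ode3_model c : exists e1 e2, model e1 e2 /\
  forall s t f, s < t -> ode3 c s t f ->
  exists a0 a1 a2, forall x, s < x < t -> f x = a0 + (a1 * e1 x + a2 * e2 x).
Proof.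
have [c0|c0|c0] := ltgtP c 0.
- pose mu := Num.sqrt (- c); have mu0 : mu != 0 by rewrite gt_eqF// sqrtr_gt0; lra.
  have cE : c = - (mu * mu) by rewrite -expr2 sqr_sqrtr; lra.
  exists (fun x => sin (mu * x)), (fun x => cos (mu * x)).
  split; first exact: TrigModel.
  move=> s t f st; rewrite /ode3 cE.
  set f1 := derive1 f; set f2 := derive1 f1 => ode.
  have [A AE] : exists A, forall x, s < x < t ->
      f2 x * cos (mu * x) + mu * (f1 x * sin (mu * x)) = A.
    apply: cst_of_drv => // x /ode[_ h1 h2].
    have hs := drv_sinM mu x; have hc := drv_cosM mu x.
    apply: drv_eq (drvD (drvM h2 hc) (drvZ mu (drvM h1 hs))) _; ring.
  have [B BE] : exists B, forall x, s < x < t ->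
      f2 x * sin (mu * x) - mu * (f1 x * cos (mu * x)) = B.
    apply: cst_of_drv => // x /ode[_ h1 h2].
    have hs := drv_sinM mu x; have hc := drv_cosM mu x.
    apply: drv_eq (drvB (drvM h2 hs) (drvZ mu (drvM h1 hc))) _; ring.
  have [|c1 c1E] := @span_of_drv (fun x => sin (mu * x)) (fun x => cos (mu * x))
    (fun x => mu * cos (mu * x)) (fun x => - mu * sin (mu * x)) f f1
    (- B / mu ^+ 2) (- A / mu ^+ 2) s t st (drv_sinM mu) (drv_cosM mu)
    (fun x xI => let: And3 h _ _ := ode x xI in h) _.
    move=> x xI; rewrite -(AE x xI) -(BE x xI).
    transitivity (f1 x * (cos (mu * x) ^+ 2 + sin (mu * x) ^+ 2)).
      by rewrite cos2Dsin2 mulr1.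
    by field.
  by exists c1, (- B / mu ^+ 2), (- A / mu ^+ 2).
- pose mu := Num.sqrt c; have mu0 : mu != 0 by rewrite gt_eqF// sqrtr_gt0; lra.
  have cE : c = mu * mu by rewrite -expr2 sqr_sqrtr; lra.
  exists (fun x => expR (mu * x)), (fun x => expR (- mu * x)).
  split; first exact: ExpModel.
  move=> s t f st; rewrite /ode3 cE.
  set f1 := derive1 f; set f2 := derive1 f1 => ode.
  have [A AE] : exists A, forall x, s < x < t ->
      (f2 x + mu * f1 x) * expR (- mu * x) = A.
    apply: cst_of_drv => // x /ode[_ h1 h2].
    apply: drv_eq (drvM (drvD h2 (drvZ mu h1)) (drv_expM (- mu) x)) _; ring.
  have [B BE] : exists B, forall x, s < x < t ->
      (f2 x - mu * f1 x) * expR (mu * x) = B.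
    apply: cst_of_drv => // x /ode[_ h1 h2].
    apply: drv_eq (drvM (drvB h2 (drvZ mu h1)) (drv_expM mu x)) _; ring.
  have [|c1 c1E] := @span_of_drv (fun x => expR (mu * x)) (fun x => expR (- mu * x))
    (fun x => mu * expR (mu * x)) (fun x => - mu * expR (- mu * x)) f f1
    (A / (2 * mu ^+ 2)) (B / (2 * mu ^+ 2)) s t st (drv_expM mu) (drv_expM (- mu))
    (fun x xI => let: And3 h _ _ := ode x xI in h) _.
    move=> x xI; rewrite -(AE x xI) -(BE x xI) !mulNr !expRN.
    have E0 : expR (mu * x) != 0 by rewrite gt_eqF ?expR_gt0.
    by field; rewrite mu0 E0.
  by exists c1, (A / (2 * mu ^+ 2)), (B / (2 * mu ^+ 2)).
- exists (fun x => x), (fun x => x ^+ 2); split; first exact: QuadModel.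
  move=> s t f st; rewrite /ode3 c0.
  set f1 := derive1 f; set f2 := derive1 f1 => ode.
  have [A AE] : exists A, forall x, s < x < t -> f2 x = A.
    by apply: cst_of_drv => // x /ode[_ _]; rewrite mul0r.
  have [B BE] : exists B, forall x, s < x < t -> f1 x - A * x = B.
    apply: cst_of_drv => // x xI; have [_ h1 _] := ode x xI.
    apply: drv_eq (drvB h1 (drvZ A (drv_id x))) _.
    by rewrite AE// mulr1 subrr.
  have sqD (x : R) : is_derive x 1 (fun y => y ^+ 2) (2 * x).
    by rewrite (_ : (fun y => y ^+ 2) = fun y => y * y)//; drv_as; ring.
  have [|c1 c1E] := @span_of_drv (fun x => x) (fun x => x ^+ 2)
    (fun=> 1) (fun x => 2 * x) f f1 B (A / 2) s t st (@drv_id _) sqD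
    (fun x xI => let: And3 h _ _ := ode x xI in h) _.
    by move=> x xI; rewrite -(BE x xI); field.
  by exists c1, B, (A / 2).
Qed.

End Models.

(** * Extension of a solution by reflection *)

Section Extension.
Context {R : realType}.
Variables (J : set R) (k : R -> R) (al be : R) (f g F G : R -> R).
Hypothesis cv : curve J k al be f g F G.
Hypothesis albe : al = be.
Variables (e1 e2 d1 d2 dd1 dd2 : R -> R) (a0 a1 a2 b0 b1 b2 : R).
Hypothesis mp : midpoint_pair e1 e2 d1 d2 dd1 dd2.
Hypothesis indep : a1 * b2 - a2 * b1 != 0.
Implicit Types (s t u v w x y m r A B : R).

Let fh x := a0 + (a1 * e1 x + a2 * e2 x).
Let gh x := b0 + (b1 * e1 x + b2 * e2 x).
Let agree x := f x = fh x /\ g x = gh x.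

Let fh1 x := a1 * d1 x + a2 * d2 x.
Let gh1 x := b1 * d1 x + b2 * d2 x.

Let fhD x : is_derive x 1 fh (fh1 x).
Proof.
have := mp_d1 mp x; have := mp_d2 mp x => H1 H2.
by rewrite /fh; drv_as; rewrite /fh1; ring.
Qed.

Let ghD x : is_derive x 1 gh (gh1 x).
Proof.
have := mp_d1 mp x; have := mp_d2 mp x => H1 H2.
by rewrite /gh; drv_as; rewrite /gh1; ring.
Qed.

Let sym_eq w y : J w -> J y -> J (2 * w - y) -> y != w ->
  (f y - f (2 * w - y)) * G w = (g y - g (2 * w - y)) * F w.
Proof.
move=> Jw Jy Ju yw.
have E := cv_albe cv; rewrite -albe in E.
have alE : al = 1 / 2 by lra.
have mid u v : u = 2 * w - v -> al * u + be * v = w.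
  by move=> ->; rewrite -albe alE; field.
have [lt|gt|eq] := ltgtP (2 * w - y) y.
- by have := cv_eq cv Ju Jy lt; rewrite mid.
- have := cv_eq cv Jy Ju gt; rewrite mid; last ring.
  by move=> E'; rewrite -opprB mulNr E' -mulNr opprB.
- by move/eqP: yw; case; lra.
Qed.

(** Reflecting [y] in the points [w] of an interval lands where the curve is
    known, which puts the error at [y] in the direction of all the tangents at
    such [w]; these directions are not constant. *)
Let agree_by_reflection A B y : A < B -> J y ->
  (forall w, A < w < B -> [/\ J w, J (2 * w - y), y != w, agree w & agree (2 * w - y)]) ->
  agree y.
Proof.
move=> AB Jy refl.
pose p := f y - fh y; pose q := g y - gh y.
pose phi x := p * gh1 x - q * fh1 x.
have phi0 w : A < w < B -> k w != 0 -> phi w = 0.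
  move=> wI kw; have [Jw Ju yw agw [fu gu]] := refl w wI.
  have near_agree : \forall x \near w, agree x.
    by have := near_oo_id wI; apply: filterS => x /refl[].
  have Fw : F w = fh1 w * k w.
    apply: (vel_chain (curve_vel1 cv)) => //; apply: drv_near (fhD w).
    by move: near_agree; apply: filterS => x [-> _].
  have Gw : G w = gh1 w * k w.
    apply: (vel_chain (curve_vel2 cv)) => //; apply: drv_near (ghD w).
    by move: near_agree; apply: filterS => x [_ ->].
  have := sym_eq Jw Jy Ju yw; rewrite Fw Gw !mulrA => /(mulIf kw).
  have [l lE] := mp_chord mp (y - w); have [l1 l2] := lE w.
  have wy : w + (y - w) = y by ring.
  have wu : w - (y - w) = 2 * w - y by ring.
  rewrite wy wu in l1 l2; rewrite fu gu => E.
  have hf : fh y - fh (2 * w - y) = l * fh1 w.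
    transitivity (a1 * (e1 y - e1 (2 * w - y)) + a2 * (e2 y - e2 (2 * w - y))).
      by rewrite /fh; ring.
    by rewrite l1 l2 /fh1; ring.
  have hg : gh y - gh (2 * w - y) = l * gh1 w.
    transitivity (b1 * (e1 y - e1 (2 * w - y)) + b2 * (e2 y - e2 (2 * w - y))).
      by rewrite /gh; ring.
    by rewrite l1 l2 /gh1; ring.
  rewrite /phi /p /q.
  transitivity ((f y - fh (2 * w - y)) * gh1 w - (g y - gh (2 * w - y)) * fh1 w -
    ((fh y - fh (2 * w - y)) * gh1 w - (gh y - gh (2 * w - y)) * fh1 w)).
    by ring.
  by rewrite E hf hg; ring.
pose phi1 x := p * (b1 * dd1 x + b2 * dd2 x) - q * (a1 * dd1 x + a2 * dd2 x).
have phiD x : is_derive x 1 phi (phi1 x).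
  have := mp_dd1 mp x; have := mp_dd2 mp x => H1 H2.
  by rewrite /phi /fh1 /gh1; drv_as; rewrite /phi1; ring.
have phiE w : A < w < B -> phi w = 0.
  move=> wI; apply: cts_eq0_adherent; first exact: drv_cts (phiD w).
  move=> e e0; pose x := Num.max A (w - e); pose x' := (x + w) / 2.
  have xA : A <= x by rewrite le_max lexx.
  have xe : w - e <= x by rewrite le_max lexx orbT.
  have xw : x < w by rewrite gt_max; lra.
  have [J1 _ _ _ _] : [/\ J x', J (2 * x' - y), y != x', agree x' & agree (2 * x' - y)].
    by apply: refl; rewrite /x'; lra.
  have [J2 _ _ _ _] := refl w wI.
  have x'w : x' < w by rewrite /x'; lra.
  have [z zI kz] := cv_dense cv x'w J1 J2.
  have xx' : x < x' by rewrite /x'; lra.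
  by exists z; split; [lra|lra|apply: phi0 => //; lra].
pose w := (A + B) / 2; have wI : A < w < B by rewrite /w; lra.
have E0 := phiE w wI.
have E1 : phi1 w = 0.
  have H : is_derive w 1 phi 0.
    have := drv_cst 0 w; apply: drv_near.
    by have := near_oo_id wI; apply: filterS => x /phiE ->.
  by rewrite -(drv1 (phiD w)) (drv1 H).
have W0 := mp_wronskian mp w.
suff [p0 q0] : p = 0 /\ q = 0.
  by split; apply/eqP; rewrite -subr_eq0; apply/eqP.
have D0 := mulf_neq0 indep W0.
split; apply: (mulIf D0); rewrite mul0r.
- transitivity (fh1 w * phi1 w - (a1 * dd1 w + a2 * dd2 w) * phi w).
    by rewrite /phi /phi1 /fh1 /gh1; ring.
  by rewrite E0 E1 !mulr0 subrr.
- transitivity (gh1 w * phi1 w - (b1 * dd1 w + b2 * dd2 w) * phi w).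
    by rewrite /phi /phi1 /fh1 /gh1; ring.
  by rewrite E0 E1 !mulr0 subrr.
Qed.

(** The region of agreement is enlarged from radius [rho] to [rho + r] about
    the midpoint [m]. For [y] in the larger region, reflect in points [w] that
    lie between [m] and [y] and are closer to [m] than [rho]: past the middle
    of [m] and [y], their reflections of [y] are still between [m] and [w]. *)
Lemma agree_extends s t : s < t -> (forall x, s < x < t -> J x /\ agree x) ->
  forall x, J x -> agree x.
Proof.
move=> st base; pose m := (s + t) / 2; pose r := (t - s) / 2.
have r0 : 0 < r by rewrite /r; lra.
have Jm : J m by apply: (base m _).1; rewrite /m; lra.
suff grow n : forall x, J x -> m - r *+ n.+1 < x < m + r *+ n.+1 -> agree x.
  move=> x Jx; have [n xn] : exists n, `|x - m| / r < n%:R.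
    by exists (Num.truncn (`|x - m| / r)).+1; exact: truncnS_gt.
  apply: (grow n) => //; rewrite -mulr_natr.
  have : `|x - m| < r * n.+1%:R.
    rewrite mulrC -ltr_pdivrMr// (lt_le_trans xn)// ler_nat//.
  by rewrite ltr_norml; lra.
elim: n => [|n IH] y Jy.
  by rewrite mulr1n => yI; apply: (base y _).2; rewrite /m /r in yI; lra.
pose rho := r *+ n.+1; rewrite mulrSr -/rho => yI.
have rr : r <= rho by rewrite /rho mulrS lerDl mulrn_wge0// ltW.
have {}IH x : J x -> m - rho < x < m + rho -> agree x by exact: IH.
have [yin|yout] := boolP (m - rho < y < m + rho); first exact: IH.
have [ym|my|ym] := ltgtP y m; last by move: yout; rewrite ym; lra.
- have yr : y <= m - rho by move: yout; rewrite negb_and -!leNgt => /orP[]; lra.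
  apply: (@agree_by_reflection (m - rho) ((m + y) / 2)) => //; first lra.
  move=> w wI; have Jw : J w by apply: (cv_itv cv Jy Jm); lra.
  have Ju : J (2 * w - y) by apply: (cv_itv cv Jw Jm); lra.
  split=> //; [by rewrite lt_eqF//; lra|by apply: IH => //; lra|].
  by apply: IH => //; lra.
- have yr : m + rho <= y by move: yout; rewrite negb_and -!leNgt => /orP[]; lra.
  apply: (@agree_by_reflection ((m + y) / 2) (m + rho)) => //; first lra.
  move=> w wI; have Jw : J w by apply: (cv_itv cv Jm Jy); lra.
  have Ju : J (2 * w - y) by apply: (cv_itv cv Jm Jw); lra.
  split=> //; [by rewrite gt_eqF//; lra|by apply: IH => //; lra|].
  by apply: IH => //; lra.
Qed.

End Extension.

(** * Propagation of straight pieces *)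

Section Lines.
Context {R : realType}.
Implicit Types (S J : set R) (f g : R -> R) (a b s t x y z e : R).

(** Testing three points at a time makes the notion pass to unions of chains;
    [collinear_onP] recovers the line. *)
Definition collinear_on S f g := forall x y z, S x -> S y -> S z ->
  (f y - f x) * (g z - g x) = (g y - g x) * (f z - f x).

Lemma collinear_onP S f g : collinear_on S f g <->
  exists a b, (a != 0 \/ b != 0) /\
    forall x y, S x -> S y -> a * f x + b * g x = a * f y + b * g y.
Proof.
split=> [col|[a [b [ab0 line]]] x y z Sx Sy Sz].
  have [triv|] := pselect (forall x y, S x -> S y -> f x = f y /\ g x = g y).
    exists 1, 0; split; first by left; rewrite oner_eq0.
    by move=> x y Sx Sy; have [-> ->] := triv x y Sx Sy.
  move=> /existsNP[x /existsNP[y /not_implyP[Sx /not_implyP[Sy fg]]]].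
  have lineP z : S z -> (g y - g x) * f z - (f y - f x) * g z =
      (g y - g x) * f x - (f y - f x) * g x.
    move=> Sz; have /eqP := col x y z Sx Sy Sz; rewrite -subr_eq0 => /eqP E.
    apply/eqP; rewrite -subr_eq0 -oppr_eq0; apply/eqP; rewrite -[RHS]E; ring.
  exists (g y - g x), (- (f y - f x)); split.
    have [gxy|] := eqVneq (g y - g x) 0; last by left.
    have [fxy|] := eqVneq (f y - f x) 0; last by right; rewrite oppr_eq0.
    by exfalso; apply: fg; split; apply/esym/eqP; rewrite -subr_eq0; apply/eqP.
  by move=> z z' Sz Sz'; rewrite !mulNr !lineP.
have Ey : a * (f y - f x) + b * (g y - g x) = 0.
  have /eqP := line y x Sy Sx; rewrite -subr_eq0 => /eqP <-; ring.
have Ez : a * (f z - f x) + b * (g z - g x) = 0.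
  have /eqP := line z x Sz Sx; rewrite -subr_eq0 => /eqP <-; ring.
apply/eqP; rewrite -subr_eq0; apply/eqP; case: ab0 => [a0|b0].
  apply: (mulfI a0); rewrite mulr0.
  transitivity ((a * (f y - f x) + b * (g y - g x)) * (g z - g x) -
    (a * (f z - f x) + b * (g z - g x)) * (g y - g x)); first by ring.
  by rewrite Ey Ez !mul0r subrr.
apply: (mulfI b0); rewrite mulr0.
transitivity ((a * (f z - f x) + b * (g z - g x)) * (f y - f x) -
  (a * (f y - f x) + b * (g y - g x)) * (f z - f x)); first by ring.
by rewrite Ey Ez !mul0r subrr.
Qed.

Lemma collinear_base S f g a b : (forall x y, S x -> S y ->
    (f x - a) * (g y - b) = (g x - b) * (f y - a)) -> collinear_on S f g.
Proof.
move=> base x y z Sx Sy Sz.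
have /eqP := base y z Sy Sz; rewrite -subr_eq0 => /eqP E1.
have /eqP := base y x Sy Sx; rewrite -subr_eq0 => /eqP E2.
have /eqP := base x z Sx Sz; rewrite -subr_eq0 => /eqP E3.
apply/eqP; rewrite -subr_eq0; apply/eqP.
transitivity ((f y - a) * (g z - b) - (g y - b) * (f z - a) -
  ((f y - a) * (g x - b) - (g y - b) * (f x - a)) -
  ((f x - a) * (g z - b) - (g x - b) * (f z - a))); first by ring.
by rewrite E1 E2 E3 !subr0.
Qed.

Definition collinear J f g s t := collinear_on [set x | J x /\ s < x < t] f g.

Lemma collinear_sub J f g s t s' t' : s <= s' -> t' <= t ->
  collinear J f g s t -> collinear J f g s' t'.
Proof.
by move=> ss tt col x y z [Jx xI] [Jy yI] [Jz zI]; apply: col; split => //; lra.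
Qed.

Lemma collinear_reflect J f g s t : collinear J f g s t <->
  collinear (fun x => J (- x)) (fun x => f (- x)) (fun x => g (- x)) (- t) (- s).
Proof.
split=> col x y z [Jx xI] [Jy yI] [Jz zI].
  by apply: col; split => //; lra.
have := col (- x) (- y) (- z); rewrite !opprK; apply; split => //=; rewrite ?opprK//; lra.
Qed.

(** The source of maximal straight pieces. *)
Lemma stuck_at (P : R -> Prop) t0 t1 :
  (forall t t', t' <= t -> P t -> P t') ->
  (forall t, (forall t', t' < t -> P t') -> P t) ->
  P t0 -> ~ P t1 ->
  exists t, [/\ t0 <= t, P t & forall e, 0 < e -> ~ P (t + e)].
Proof.
move=> mono clos P0 P1.
have ub t : P t -> t <= t1.
  by move=> Pt; rewrite leNgt; apply/negP => /ltW/mono/(_ Pt).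
have hs : has_sup [set t | P t].
  by split; [exists t0|exists t1 => t /ub].
exists (sup [set t | P t]); split.
- by apply: ub_le_sup => //; exact: hs.2.
- apply: clos => t' lt'; have e0 : 0 < sup [set t | P t] - t' by rewrite subr_gt0.
  have [t Pt tt] := sup_adherent e0 hs.
  by apply: (mono t) => //; apply: ltW; rewrite subKr in tt.
- move=> e e0 Pe; have : sup [set t | P t] + e <= sup [set t | P t].
    by apply: ub_le_sup => //; exact: hs.2.
  by lra.
Qed.

Lemma stuck_right J f g s t t' : collinear J f g s t -> ~ collinear J f g s t' ->
  exists t1, [/\ t <= t1, collinear J f g s t1 &
    forall e, 0 < e -> ~ collinear J f g s (t1 + e)].
Proof.
move=> col ncol; apply: (stuck_at (P := collinear J f g s)) col ncol.
  by move=> x y yx; exact: collinear_sub.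
move=> z col x y w [Jx xI] [Jy yI] [Jw wI].
pose m := Num.max x (Num.max y w); pose t1 := (m + z) / 2.
have xm : x <= m by rewrite le_max lexx.
have ym : y <= m by rewrite !le_max lexx orbT.
have wm : w <= m by rewrite !le_max lexx !orbT.
have mz : m < z by rewrite !gt_max; apply/and3P; split; lra.
by apply: (col t1); rewrite /t1; first lra; split => //; lra.
Qed.

Lemma stuck_left J f g s s' t : collinear J f g s t -> ~ collinear J f g s' t ->
  exists s1, [/\ s1 <= s, collinear J f g s1 t &
    forall e, 0 < e -> ~ collinear J f g (s1 - e) t].
Proof.
move=> /collinear_reflect col ncol.
have {}ncol : ~ collinear (fun x => J (- x)) (fun x => f (- x))
  (fun x => g (- x)) (- t) (- s').
  by move=> h; apply: ncol; apply/collinear_reflect.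
have [t1 [tt1 col1 stuck]] := stuck_right col ncol.
exists (- t1); split; first lra.
  by apply/collinear_reflect; rewrite opprK.
move=> e e0 /collinear_reflect; rewrite opprB opprK addrC; exact: stuck.
Qed.

End Lines.

Section Propagation.
Context {R : realType}.
Implicit Types (J : set R) (k f g F G : R -> R) (a b al be s t u v w x y e : R).

Lemma al_be_mix al be x y : 0 < al -> 0 < be -> al + be = 1 -> x < y ->
  x < al * x + be * y < y.
Proof.
move=> al0 be0 albe xy; have p : 0 < al * (y - x) by rewrite mulr_gt0 ?subr_gt0.
have q : 0 < be * (y - x) by rewrite mulr_gt0 ?subr_gt0.
have alE : al = 1 - be by lra.
by rewrite alE in p *; lra.
Qed.

(** The left endpoint of the chord over [w] with right endpoint [x], and its
    position relative to a point [s]. *)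
Lemma left_end al be s x w : 0 < al -> 0 < be -> al + be = 1 ->
  al * s + be * x < w -> w < x ->
  exists u, [/\ s < u, u < w & al * u + be * x = w].
Proof.
move=> al0 be0 albe sw wx; exists ((w - be * x) / al).
have aln0 : al != 0 by rewrite gt_eqF.
have E : al * ((w - be * x) / al) + be * x = w by field.
split=> //.
  by rewrite ltr_pdivlMr// mulrC; lra.
rewrite ltr_pdivrMr//.
have p : 0 < be * (x - w) by rewrite mulr_gt0 ?subr_gt0.
have -> : w * al = w - be * w by rewrite (_ : al = 1 - be); [ring|lra].
lra.
Qed.

Lemma right_end al be x w : 0 < al -> 0 < be -> al + be = 1 -> x < w ->
  exists v, w < v /\ al * x + be * v = w.
Proof.
move=> al0 be0 albe xw; exists ((w - al * x) / be).
have ben0 : be != 0 by rewrite gt_eqF.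
have E : al * x + be * ((w - al * x) / be) = w by field.
split=> //; rewrite ltr_pdivlMr//.
have p : 0 < al * (w - x) by rewrite mulr_gt0 ?subr_gt0.
have -> : w * be = w - al * w by rewrite (_ : be = 1 - al); [ring|lra].
lra.
Qed.

(** Where every point is active, a straight piece grows to the right by a
    fixed proportion of its length, hence indefinitely. *)
Lemma line_right J k al be f g F G a b s t :
  curve J k al be f g F G -> (forall w, J w -> active J F G w) ->
  (a != 0 \/ b != 0) -> s < t -> J s -> J t ->
  (forall x y, s < x < t -> s < y < t -> J x -> J y ->
    a * f x + b * g x = a * f y + b * g y) ->
  forall x y, s < x -> s < y -> J x -> J y ->
    a * f x + b * g x = a * f y + b * g y.
Proof.
move=> cv act ab0 st Js Jt line; have [al0 be0 albe] := And3 (cv_al cv) (cv_be cv) (cv_albe cv).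
pose q x := a * f x + b * g x; pose m := (s + t) / 2.
have mI : s < m < t by rewrite /m; lra.
have Jm : J m by apply: (cv_itv cv Js Jt); lra.
pose de := al / be * (t - s).
have de0 : 0 < de by rewrite !mulr_gt0 ?invr_gt0 ?subr_gt0.
suff grow n x : J x -> s < x < t + de *+ n -> q x = q m.
  suff qm x : J x -> s < x -> q x = q m by move=> x y sx sy Jx Jy; rewrite -/(q x) -/(q y) !qm.
  move=> Jx sx; apply: (grow (Num.truncn (`|x - t| / de)).+1) => //.
  have := truncnS_gt (`|x - t| / de); rewrite ltr_pdivrMr// mulrC -mulr_natr => H.
  by have := ler_norm (x - t); lra.
elim: n x => [|n IH] x Jx; first by rewrite mulr0n addr0 => xI; apply: line => //; lra.
rewrite mulrSr addrA; set T := t + de *+ n in IH *; move=> xI.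
have tT : t <= T by rewrite lerDl mulrn_wge0// ltW.
have [xT|Tx] := ltP x T; first by apply: IH => //; lra.
have bede : be * de = al * (t - s) by rewrite /de; field; rewrite gt_eqF.
have sxT : al * s + be * x < T.
  have p : 0 < be * (T + de - x) by rewrite mulr_gt0 ?subr_gt0//; lra.
  have r : 0 <= al * (T - t) by apply: mulr_ge0; [exact: ltW|rewrite subr_ge0].
  have alT : al * T = T - be * T by rewrite (_ : al = 1 - be); [ring|lra].
  lra.
have /andP[sx1 _] : s < al * s + be * x < x by apply: al_be_mix => //; lra.
pose w := (al * s + be * x + T) / 2.
have [||u [su uw uE]] := @left_end al be s x w al0 be0 albe; [rewrite /w; lra|rewrite /w; lra|].
have Jw : J w by apply: (cv_itv cv Js Jx); rewrite /w; lra.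
have Ju : J u by apply: (cv_itv cv Js Jx); rewrite /w in uw; lra.
have lineT y z : s < y < T -> s < z < T -> J y -> J z -> q y = q z.
  by move=> yI zI Jy Jz; rewrite !IH.
have wI : s < w < T by rewrite /w; lra.
have ux : u < x by rewrite /w in uw; lra.
have E : q u = q x by exact: (line_step cv ab0 lineT wI (act _ Jw) Ju Jx ux uE).
by rewrite -E; apply: IH => //; lra.
Qed.

Lemma active_reflect J F G w : active J F G (- w) ->
  active (fun x => J (- x)) (fun x => - F (- x)) (fun x => - G (- x)) w.
Proof. by case=> Jw FG; split=> //; rewrite !oppr_eq0. Qed.

Lemma collinear_active J k al be f g F G s t :
  curve J k al be f g F G -> (forall w, J w -> active J F G w) ->
  s < t -> J s -> J t -> collinear J f g s t -> collinear_on J f g.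
Proof.
move=> cv act st Js Jt /collinear_onP[a [b [ab0 line]]].
have {}line x y : s < x < t -> s < y < t -> J x -> J y ->
    a * f x + b * g x = a * f y + b * g y by move=> ? ? ? ?; exact: line.
have right := line_right cv act ab0 st Js Jt line.
have left x y : x < t -> y < t -> J x -> J y ->
    a * f x + b * g x = a * f y + b * g y.
  move=> xt yt Jx Jy; rewrite -[x]opprK -[y]opprK.
  apply: (@line_right (fun x => J (- x)) _ _ _ (fun x => f (- x)) (fun x => g (- x))
    _ _ a b (- t) (- s) (curve_reflect cv)) => //; rewrite ?opprK//; try lra.
  - by move=> w Jw; apply: active_reflect; exact: act.
  - by move=> p q pI qI Jp Jq; apply: line => //; lra.
pose m := (s + t) / 2; have mI : s < m < t by rewrite /m; lra.
have Jm : J m by apply: (cv_itv cv Js Jt); lra.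
apply/collinear_onP; exists a, b; split=> //.
suff all x : J x -> a * f x + b * g x = a * f m + b * g m.
  by move=> x y Jx Jy; rewrite !all.
move=> Jx; have [sx|xs] := ltP s x; first by apply: right => //; lra.
by apply: left => //; lra.
Qed.

End Propagation.

Section Unbounded.
Context {R : realType}.
Implicit Types (J : set R) (k f g F G : R -> R) (a b al be s t u v w x y e : R).

(** An active point to the right of the weighted mean of [s] and [t] would, by
    [line_step], carry the line beyond [t]. So nothing moves there, and motion
    must resume at [t] if the piece is to end there. *)
Lemma stuck_right_idle J k al be f g F G s t :
  curve J k al be f g F G -> s < t -> J s -> J t -> collinear J f g s t ->
  (forall e, 0 < e -> ~ collinear J f g s (t + e)) ->
  (forall x, al * s + be * t <= x <= t -> f x = f t /\ g x = g t) /\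
  active_limit J F G t.
Proof.
move=> cv st Js Jt col stuck.
have [al0 be0 albe] := And3 (cv_al cv) (cv_be cv) (cv_albe cv).
have /andP[sc ct] := al_be_mix al0 be0 albe st; set c := _ + _ in sc ct *.
have /collinear_onP[a [b [ab0 line]]] := col.
have {}line x y : s < x < t -> s < y < t -> J x -> J y ->
    a * f x + b * g x = a * f y + b * g y by move=> ? ? ? ?; exact: line.
pose m := (s + t) / 2; have mI : s < m < t by rewrite /m; lra.
have Jm : J m by apply: (cv_itv cv Js Jt); lra.
have extend e : 0 < e -> ~ (forall x, t <= x < t + e -> J x ->
    exists y, [/\ s < y < t, J y & a * f x + b * g x = a * f y + b * g y]).
  move=> e0 ext; apply: (stuck e e0); apply/collinear_onP; exists a, b; split=> //.
  suff all x : J x -> s < x < t + e -> a * f x + b * g x = a * f m + b * g m.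
    by move=> x y [Jx xI] [Jy yI]; rewrite !all.
  move=> Jx xI; have [xt|tx] := ltP x t; first by apply: line => //; lra.
  have [|//|y [yI Jy ->]] := ext x; first lra.
  exact: line.
have idle w : c < w < t -> ~ active J F G w.
  move=> wI act.
  have e0 : 0 < (w - c) / be by rewrite divr_gt0// subr_gt0; lra.
  apply: (extend _ e0) => x xI Jx.
  have be_e : be * ((w - c) / be) = w - c by field; rewrite gt_eqF.
  have p : 0 < be * (t + (w - c) / be - x) by rewrite mulr_gt0 ?subr_gt0//; lra.
  have sxw : al * s + be * x < w by rewrite /c in be_e p; lra.
  have [|u [su uw uE]] := left_end al0 be0 albe sxw; first lra.
  have Ju : J u by apply: (cv_itv cv Js Jx); lra.
  exists u; split=> //; first lra.
  apply/esym/(line_step cv ab0 line _ act Ju Jx _ uE); lra.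
split.
  move=> x xI; have Jx : J x by apply: (cv_itv cv Js Jt); lra.
  by apply: (idle_cst cv idle) => //; lra.
move=> e e0; apply: contrapT => nact.
pose s' := Num.max s (t - e).
have ss' : s <= s' by rewrite le_max lexx.
have es' : t - e <= s' by rewrite le_max lexx orbT.
have s't : s' < t by rewrite gt_max st; lra.
pose y := (s' + t) / 2; have yI : s < y < t by rewrite /y; lra.
have Jy : J y by apply: (cv_itv cv Js Jt); lra.
apply: (extend e e0) => x xI Jx; exists y; split=> //.
have idle' w : y <= w <= x -> ~ active J F G w.
  by move=> wI act; apply: nact; exists w; split=> //; rewrite /y in wI; lra.
have [-> ->] // : f x = f y /\ g x = g y.
have idle'' w : y < w < x -> ~ active J F G w by move=> wI; apply: idle'; lra.
by apply: (idle_cst cv idle'') => //; lra.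
Qed.

(** At a limit of active points where the curve arrives constantly, the chords
    over that point are differences with a fixed point, and they are parallel:
    the curve leaves along a line. *)
Lemma limit_extends J k al be f g F G s t :
  curve J k al be f g F G -> s < t -> J s -> J t -> active_limit J F G t ->
  (forall x, s <= x <= t -> f x = f t /\ g x = g t) ->
  exists2 e, 0 < e & collinear J f g s (t + e).
Proof.
move=> cv st Js Jt lim cst.
have [al0 be0 albe] := And3 (cv_al cv) (cv_be cv) (cv_albe cv).
have e0 : 0 < al * (t - s) / be by rewrite divr_gt0// mulr_gt0// subr_gt0.
exists (al * (t - s) / be) => //; apply: (@collinear_base _ _ _ _ (f t) (g t)).
have chord x : J x -> t < x < t + al * (t - s) / be ->
    exists u, [/\ J u, u < x, al * u + be * x = t, f u = f t & g u = g t].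
  move=> Jx xI.
  have be_e : be * (al * (t - s) / be) = al * t - al * s by field; rewrite gt_eqF.
  have p : 0 < be * (t + al * (t - s) / be - x) by rewrite mulr_gt0 ?subr_gt0//; lra.
  have alt : al * t = t - be * t by rewrite (_ : al = 1 - be); [ring|lra].
  have sxt : al * s + be * x < t by lra.
  have [|u [su ut uE]] := left_end al0 be0 albe sxt; first lra.
  have Ju : J u by apply: (cv_itv cv Js Jx); lra.
  have [fu gu] : f u = f t /\ g u = g t by apply: cst; lra.
  by exists u; split=> //; lra.
move=> x y [Jx xI] [Jy yI].
have [xt|tx] := leP x t.
  by have [-> ->] : f x = f t /\ g x = g t by [apply: cst; lra]; rewrite !subrr !mul0r.
have [yt|ty] := leP y t.
  by have [-> ->] : f y = f t /\ g y = g t by [apply: cst; lra]; rewrite !subrr !mulr0.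
have [|u [Ju ux uE fu gu]] := chord x Jx; first lra.
have [|v [Jv vy vE fv gv]] := chord y Jy; first lra.
by have := fiber_parallel cv Jt lim Ju Jx Jv Jy ux vy uE vE; rewrite fu gu fv gv.
Qed.

(** A bounded straight piece that extends on neither side would be constant,
    and constant pieces extend. *)
Lemma not_doubly_stuck J k al be f g F G s t :
  curve J k al be f g F G -> s < t -> J s -> J t -> collinear J f g s t ->
  (forall e, 0 < e -> ~ collinear J f g s (t + e)) ->
  ~ (forall e, 0 < e -> ~ collinear J f g (s - e) t).
Proof.
move=> cv st Js Jt col stuckr stuckl.
have [al0 be0 albe] := And3 (cv_al cv) (cv_be cv) (cv_albe cv).
have [cstr lim] := stuck_right_idle cv st Js Jt col stuckr.
have /andP[sc ct] := al_be_mix al0 be0 albe st.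
have [||||e e0|cstl _] := @stuck_right_idle _ _ _ _ _ _ _ _ (- t) (- s) (curve_reflect cv).
- by rewrite ltrN2.
- by rewrite opprK.
- by rewrite opprK.
- exact: (collinear_reflect _ _ _ _ _).1.
- rewrite (_ : - s + e = - (s - e)); last by ring.
  by move=> /(collinear_reflect _ _ _ _ _).2; exact: stuckl.
rewrite !opprK in cstl.
have fgc := cstr (al * s + be * t).
have cst x : s <= x <= t -> f x = f t /\ g x = g t.
  move=> xI; have [xc|cx] := leP x (al * s + be * t); last by apply: cstr; lra.
  have [E1 E2] := cstl (- x) ltac:(lra); rewrite opprK in E1 E2.
  have [E3 E4] := cstl (- (al * s + be * t)) ltac:(lra); rewrite opprK in E3 E4.
  have [E5 E6] := fgc ltac:(lra).
  by rewrite E1 E2 -E3 -E4.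
have [e e0 /stuckr] := limit_extends cv st Js Jt lim cst; exact.
Qed.

(** Every point to the left of an active [w] of the half-line is the start of a
    chord over [w] that ends in the half-line, so it lies on the same line.
    Without such a [w] the curve is eventually constant, and the supremum of
    the active points plays the same part. *)
Lemma half_line J k al be f g F G s :
  curve J k al be f g F G -> (forall x y, J x -> x <= y -> J y) -> J s ->
  collinear_on [set x | J x /\ s < x] f g -> collinear_on J f g.
Proof.
move=> cv up Js col.
have [al0 be0 albe] := And3 (cv_al cv) (cv_be cv) (cv_albe cv).
have [[w [sw act]]|idle] := pselect (exists w, s < w /\ active J F G w).
  have /collinear_onP[a [b [ab0 line]]] := col.
  apply/collinear_onP; exists a, b; split => //.
  have Jw : J w by case: act.
  have line' x y : s < x < w + 1 -> s < y < w + 1 -> J x -> J y ->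
      a * f x + b * g x = a * f y + b * g y.
    by move=> xI yI Jx Jy; apply: line; split=> //; lra.
  suff all x : J x -> a * f x + b * g x = a * f w + b * g w.
    by move=> x y Jx Jy; rewrite !all.
  move=> Jx; have [sx|xs] := ltP s x; first by apply: line.
  have xw : x < w by lra.
  have [v [wv vE]] := right_end al0 be0 albe xw.
  have Jv : J v by apply: up Jw _; exact: ltW.
  transitivity (a * f v + b * g v); last by apply: line; split=> //; lra.
  by apply: (line_step cv ab0 line' _ act Jx Jv _ vE); lra.
have [[n actn]|none] := pselect (exists n, active J F G n); last first.
  apply: (@collinear_base _ _ _ _ (f s) (g s)) => x y Jx Jy.
  have fgs z : J z -> f z = f s /\ g z = g s.
    move=> Jz; apply: (idle_cst cv (s := Num.min z s) (t := Num.max z s)) => //.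
    - by move=> w _ aw; apply: none; exists w.
    - by rewrite ge_min le_max lexx.
    - by rewrite ge_min le_max lexx !orbT.
  by have [-> ->] := fgs x Jx; rewrite !subrr !mul0r.
have ub w : active J F G w -> w <= s.
  by move=> aw; rewrite leNgt; apply/negP => sw; apply: idle; exists w.
have hs : has_sup [set w | active J F G w] by split; [exists n|exists s => w /ub].
pose s1 := sup [set w | active J F G w].
have ns1 : n <= s1 by apply: ub_le_sup => //; exact: hs.2.
have s1s : s1 <= s by apply: ge_sup => [|w /ub//]; exists n.
have Js1 : J s1 by apply: up ns1; case: actn.
have lim : active_limit J F G s1.
  move=> e e0; have [w aw we] := sup_adherent e0 hs.
  have ws1 : w <= s1 by apply: ub_le_sup => //; exact: hs.2.
  by exists w; split=> //; lra.
have cst x : s1 <= x -> f x = f s1 /\ g x = g s1.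
  move=> s1x; apply: (idle_cst cv (s := s1) (t := x)) => //; try lra.
    move=> w wI aw; have : w <= s1 by apply: ub_le_sup => //; exact: hs.2.
    by lra.
  exact: up Js1 _.
apply: (@collinear_base _ _ _ _ (f s1) (g s1)) => x y Jx Jy.
have [s1x|xs1] := leP s1 x.
  by have [-> ->] := cst x s1x; rewrite !subrr !mul0r.
have [s1y|ys1] := leP s1 y.
  by have [-> ->] := cst y s1y; rewrite !subrr !mulr0.
have [u [su uE]] := right_end al0 be0 albe xs1.
have [v [sv vE]] := right_end al0 be0 albe ys1.
have Ju : J u by apply: up Js1 _; exact: ltW.
have Jv : J v by apply: up Js1 _; exact: ltW.
have [fu gu] := cst u (ltW su); have [fv gv] := cst v (ltW sv).
have := fiber_parallel cv Js1 lim Jx Ju Jy Jv _ _ uE vE.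
rewrite fu gu fv gv -(opprB (f x)) -(opprB (g x)) -(opprB (f y)) -(opprB (g y)).
by rewrite !mulrNN; apply; lra.
Qed.

(** A right-maximal piece ends in a constant piece, which extends to a straight
    piece reaching beyond the end. Maximal on the left, this new piece cannot
    be maximal at a finite distance on the right, by [not_doubly_stuck], and
    cannot be infinite, by [half_line]. *)
Lemma collinear_unbounded J k al be f g F G s t :
  curve J k al be f g F G -> (forall x y, J x -> x <= y -> J y) ->
  s < t -> J s -> collinear J f g s t -> collinear_on J f g.
Proof.
move=> cv up st Js col; apply: contrapT => ncol.
have [al0 be0 albe] := And3 (cv_al cv) (cv_be cv) (cv_albe cv).
have bounded s' : J s' -> exists t', ~ collinear J f g s' t'.
  move=> Js'; apply: contrapT => /forallNP all; apply: ncol.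
  apply: (half_line cv up Js') => x y z [Jx xI] [Jy yI] [Jz zI].
  pose m := Num.max x (Num.max y z).
  have xm : x <= m by rewrite le_max lexx.
  have ym : y <= m by rewrite !le_max lexx orbT.
  have zm : z <= m by rewrite !le_max lexx !orbT.
  by have /contrapT := all (m + 1); apply; split => //; lra.
have [t' nt'] := bounded s Js.
have [t1 [tt1 col1 stuck1]] := stuck_right col nt'.
have st1 : s < t1 by lra.
have Jt1 : J t1 by apply: up Js _; exact: ltW.
have [cst lim] := stuck_right_idle cv st1 Js Jt1 col1 stuck1.
have /andP[sc ct1] := al_be_mix al0 be0 albe st1; set c := _ + _ in sc ct1 cst.
have Jc : J c by apply: up Js _; exact: ltW.
have [e e0 col2] := limit_extends cv ct1 Jc Jt1 lim cst.
have nst := stuck1 e e0.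
have [s3 [s3c col3 stuck3]] := stuck_left col2 nst.
have s3s : s <= s3.
  by rewrite leNgt; apply/negP => /ltW/collinear_sub sub; apply: nst; exact: sub (lexx _) col3.
have Js3 : J s3 by exact: up s3s.
have [t'' nt''] := bounded s3 Js3.
have [t4 [t14 col4 stuck4]] := stuck_right col3 nt''.
have s3t4 : s3 < t4 by lra.
have Jt4 : J t4 by apply: up Js3 _; exact: ltW.
apply: (not_doubly_stuck cv s3t4 Js3 Jt4 col4 stuck4) => e' e'0 /collinear_sub sub.
by apply: (stuck3 e' e'0); exact: sub (lexx _) t14.
Qed.

End Unbounded.

(** * From a curve without straight pieces to a regular piece *)

Section Regularization.
Context {R : realType}.
Variables (al be u0 v0 d : R) (f g K : R -> R).
Hypotheses (al0 : 0 < al) (be0 : 0 < be) (albe : al + be = 1) (d0 : 0 < d).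
Hypothesis sep : forall u v, u0 - d < u < u0 + d -> v0 - d < v < v0 + d ->
  f v - f u != 0.
Hypothesis chord : forall u v, u0 - d < u < u0 + d -> v0 - d < v < v0 + d ->
  g v - g u = K (al * u + be * v) * (f v - f u).
Let w0 := al * u0 + be * v0.
Hypothesis not_cst : forall x y, w0 - d <= x -> x < y -> y <= w0 + d ->
  ~ (exists c, forall z, x < z < y -> K z = c).
Hypothesis dense_drv : forall x y, v0 - d <= x -> x < y -> y <= v0 + d ->
  exists v, [/\ x < v < y, derivable f v 1 & derivable g v 1].

(** The chord formula transfers to [K] the differentiability of [f] and [g] at
    a single right endpoint. *)
Let K_drv w : w0 - d < w < w0 + d -> derivable K w 1.
Proof.
have d0' := d0; have aln0 : al != 0 by rewrite gt_eqF.
have ben0 : be != 0 by rewrite gt_eqF.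
move=> wI; pose x := w - w0; pose eta := Num.min (d - x) (al / be * (d + x)).
have xI : - d < x < d by rewrite /x; lra.
have eta0 : 0 < eta by rewrite lt_min mulr_gt0 ?divr_gt0//; lra.
have eta1 : eta <= d - x by rewrite ge_min lexx.
have eta2 : be * eta <= al * (d + x).
  have : be * eta <= be * (al / be * (d + x)).
    by rewrite ler_pM2l// ge_min lexx orbT.
  by rewrite (_ : be * (al / be * (d + x)) = al * (d + x))//; field.
have [|||v [vI fv gv]] := dense_drv (x := v0 + x) (y := v0 + x + eta); [lra|lra|lra|].
pose u := (w - be * v) / al.
have uw : al * u + be * v = w by rewrite /u; field.
have wE : w = al * (u0 + x) + be * (v0 + x).
  transitivity (w0 + (al + be) * x); first by rewrite albe /x; ring.
  by rewrite /w0; ring.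
have au : al * u = al * (u0 + x) + be * (v0 + x) - be * v by lra.
have uI : u0 - d < u < u0 + d.
  apply/andP; split.
    have : 0 < al * (u - (u0 - d)).
      have p : 0 < be * (v0 + x + eta - v) by rewrite mulr_gt0 ?subr_gt0//; lra.
      by rewrite mulrBr au; lra.
    by rewrite pmulr_rgt0// subr_gt0.
  have : 0 < al * (u0 + d - u).
    have p : 0 < be * (v - (v0 + x)) by rewrite mulr_gt0 ?subr_gt0//; lra.
    have p' : 0 < al * (d - x) by rewrite mulr_gt0 ?subr_gt0//; lra.
    by rewrite mulrBr au; lra.
  by rewrite pmulr_rgt0// subr_gt0.
have vI' : v0 - d < v < v0 + d by lra.
pose vv (z : R) : R := be^-1 * z + - (al / be * u).
have vvw : vv w = v by rewrite /vv -uw; field.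
have /near_oo_affine near_v : v0 - d < be^-1 * w + - (al / be * u) < v0 + d.
  by rewrite -/(vv w) vvw.
apply: (@near_eq_derivable _ _ _ (fun z => (g (vv z) - g u) / (f (vv z) - f u))).
  move: near_v; apply: filterS => z zI.
  rewrite (chord uI zI) mulfK; last exact: sep.
  by congr K; rewrite /vv; field.
have fvd := derivable_drv fv; have gvd := derivable_drv gv.
have vD : is_derive w 1 vv be^-1 by rewrite /vv; drv_as; ring.
rewrite -vvw in fvd gvd.
have Hf := drv_comp fvd vD; have Hg := drv_comp gvd vD.
have f0 : f (vv w) - f u != 0 by rewrite vvw; exact: sep.
exact: drv_derivable (drvM (drvB Hg (drv_cst (g u) w))
  (@drvV _ (fun z => f (vv z) - f u) w _ f0 (drvB Hf (drv_cst (f u) w)))).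
Qed.

(** Two chords with the same right endpoint and different slopes determine
    that endpoint, and transfer to it the differentiability of [K]. *)
Let fg_drv v : v0 - d < v < v0 + d -> derivable f v 1 /\ derivable g v 1.
Proof.
move=> vI; have d0' := d0; have albe' := albe.
have alv u : u0 - d < u < u0 + d -> w0 - d < al * u + be * v < w0 + d.
  move=> uI.
  have p1 : 0 < al * (u - (u0 - d)) by rewrite mulr_gt0 ?subr_gt0//; lra.
  have p2 : 0 < al * (u0 + d - u) by rewrite mulr_gt0 ?subr_gt0//; lra.
  have q1 : 0 < be * (v - (v0 - d)) by rewrite mulr_gt0 ?subr_gt0//; lra.
  have q2 : 0 < be * (v0 + d - v) by rewrite mulr_gt0 ?subr_gt0//; lra.
  have dd : al * d + be * d = d by rewrite -mulrDl albe mul1r.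
  by rewrite /w0; lra.
pose c := K (al * u0 + be * v).
have [u [uI Ku]] : exists u, u0 - d < u < u0 + d /\ K (al * u + be * v) - c != 0.
  apply: contrapT => /forallNP all.
  have p : 0 < al * d by rewrite mulr_gt0.
  have dd : al * d + be * d = d by rewrite -mulrDl albe mul1r.
  have q1 : 0 < be * (v - (v0 - d)) by rewrite mulr_gt0 ?subr_gt0//; lra.
  have q2 : 0 < be * (v0 + d - v) by rewrite mulr_gt0 ?subr_gt0//; lra.
  apply: (not_cst (x := al * u0 + be * v - al * d) (y := al * u0 + be * v + al * d)).
  - by rewrite /w0; lra.
  - by lra.
  - by rewrite /w0; lra.
  - exists c => z zI; have aln0 : al != 0 by rewrite gt_eqF.
    have zE : z = al * ((z - be * v) / al) + be * v by field.
    apply/eqP; rewrite -subr_eq0; apply/negPn/negP => Kz.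
    apply: (all ((z - be * v) / al)); rewrite -zE; split=> //.
    by rewrite ltr_pdivlMr// ltr_pdivrMr//; lra.
have u0I : u0 - d < u0 < u0 + d by lra.
pose K1 (z : R) : R := K (be * z + al * u); pose K2 (z : R) : R := K (be * z + al * u0).
have K1D : is_derive v 1 K1 (derive1 K (be * v + al * u) * be).
  have H : is_derive (be * v + al * u) 1 K (derive1 K (be * v + al * u)).
    by apply: derivable_drv; apply: K_drv; rewrite [be * v + _]addrC; exact: alv.
  by rewrite /K1; drv_as; ring.
have K2D : is_derive v 1 K2 (derive1 K (be * v + al * u0) * be).
  have H : is_derive (be * v + al * u0) 1 K (derive1 K (be * v + al * u0)).
    by apply: derivable_drv; apply: K_drv; rewrite [be * v + _]addrC; exact: alv.
  by rewrite /K2; drv_as; ring.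
have K12 : K1 v - K2 v != 0.
  by rewrite /K1 /K2 [_ + al * u]addrC [_ + al * u0]addrC.
have near_K12 : \forall z \near v, K1 z - K2 z != 0.
  by apply: (@cts_neq0_near _ (fun z => K1 z - K2 z)) => //; apply: drv_cts (drvB K1D K2D).
have fE : \forall z \near v,
    (g u0 - g u + K1 z * f u - K2 z * f u0) / (K1 z - K2 z) = f z.
  move: near_K12 (near_oo_id vI); apply: filterS2 => z z0 zI.
  have E1 := chord uI zI; have E2 := chord u0I zI.
  rewrite [al * u + _]addrC -/(K1 z) in E1; rewrite [al * u0 + _]addrC -/(K2 z) in E2.
  apply: (mulIf z0); rewrite divfK//.
  transitivity ((g z - g u) - (g z - g u0) + K1 z * f u - K2 z * f u0); first by ring.
  by rewrite E1 E2; ring.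
have fd : derivable f v 1.
  apply: near_eq_derivable fE _.
  have Hn := drvB (drvD (drv_cst (g u0 - g u) v) (drvM K1D (drv_cst (f u) v)))
    (drvM K2D (drv_cst (f u0) v)).
  exact: drv_derivable (drvM Hn (@drvV _ (fun z => K1 z - K2 z) v _ K12 (drvB K1D K2D))).
split=> //.
apply: (@near_eq_derivable _ _ _ (fun z => g u + K1 z * (f z - f u))).
  have := near_oo_id vI; apply: filterS => z zI.
  by rewrite /K1 addrC -[be * z + _]addrC -(chord uI zI) subrK.
exact: drv_derivable (drvD (drv_cst (g u) v)
  (drvM K1D (drvB (derivable_drv fd) (drv_cst (f u) v)))).
Qed.

(** Where [K] has a nonzero derivative, the chords of slope [c = K w] show that
    [g - c * f] has a nonzero derivative at their right endpoints. *)
Lemma regular_subinterval : exists s t c, [/\ v0 - d <= s, s < t, t <= v0 + d,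
  forall v, s < v < t -> derivable f v 1 /\ derivable g v 1 &
  forall v, s < v < t -> derive1 (fun x => g x - c * f x) v != 0].
Proof.
have d0' := d0; have albe' := albe.
have [w [wI Kw]] : exists w, w0 - d < w < w0 + d /\ derive1 K w != 0.
  apply: contrapT => /forallNP all.
  apply: (not_cst (x := w0 - d) (y := w0 + d)) => //; first lra.
  apply: cst_of_drv; first lra.
  move=> z zI; apply: drv_eq (derivable_drv (K_drv zI)) _.
  by apply/eqP/negPn/negP => Kz; apply: (all z).
pose x := w - w0; have xI : - d < x < d by rewrite /x; lra.
have aln0 : al != 0 by rewrite gt_eqF.
have near_u : \forall v \near v0 + x,
    u0 - d < (- be / al) * v + (w / al) < u0 + d.
  apply: near_oo_affine.
  have -> : - be / al * (v0 + x) + w / al = u0 + x.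
    apply: (mulfI aln0); transitivity (w - be * (v0 + x)); first by field.
    transitivity (w0 + (al + be) * x - be * (v0 + x)); first by rewrite albe /x; ring.
    by rewrite /w0; ring.
  by lra.
have near_v : \forall v \near v0 + x, v0 - d < v < v0 + d.
  by apply: near_oo_id; lra.
have /near_itvP[e e0 eP] : \forall v \near v0 + x, v0 - d < v < v0 + d /\
    u0 - d < (- be / al) * v + (w / al) < u0 + d.
  by move: near_v near_u; apply: filterS2.
pose s := Num.max (v0 - d) (v0 + x - e); pose t := Num.min (v0 + d) (v0 + x + e).
have s1 : v0 - d <= s by rewrite le_max lexx.
have s2 : v0 + x - e <= s by rewrite le_max lexx orbT.
have t1 : t <= v0 + d by rewrite ge_min lexx.
have t2 : t <= v0 + x + e by rewrite ge_min lexx orbT.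
have st : s < t by rewrite gt_max !lt_min; apply/andP; split; apply/andP; split; lra.
exists s, t, (K w); split=> //.
  by move=> v vI; apply: fg_drv; lra.
move=> v vI; have vI' : v0 - d < v < v0 + d by lra.
have [_ uI] : v0 - d < v < v0 + d /\ u0 - d < (- be / al) * v + (w / al) < u0 + d.
  by apply: eP; lra.
set u := - be / al * v + w / al in uI.
have uE : be * v + al * u = w by rewrite /u; field.
have [fv gv] := fg_drv vI'.
have fD := derivable_drv fv.
have KD := derivable_drv (K_drv wI); rewrite -uE in KD.
have H1 : is_derive v 1 (fun z => g u + (K (be * z + al * u) - K w) * (f z - f u) - K w * f u)
    (be * derive1 K (be * v + al * u) * (f v - f u)).
  by drv_as; rewrite uE; ring.
have H2 : is_derive v 1 (fun z => g z - K w * f z)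
    (be * derive1 K (be * v + al * u) * (f v - f u)).
  apply: drv_near H1; have := near_oo_id vI'; apply: filterS => z zI.
  have E := chord uI zI; rewrite [al * u + _]addrC in E.
  transitivity (g u + K (be * z + al * u) * (f z - f u) - K w * f z); first by ring.
  by rewrite -E; ring.
rewrite (drv1 H2) uE !mulf_neq0//; first by rewrite gt_eqF.
exact: sep.
Qed.

End Regularization.

(** * Classification of the curves without straight pieces *)

Section Classification.
Context {R : realType}.
Implicit Types (J : set R) (k f g F G e : R -> R) (a b al be s t u v w x y : R).

Definition spanned e1 e2 J f :=
  exists a b c, forall x, J x -> f x = a + (b * e1 x + c * e2 x).

Lemma not_collinear_active_limit J k al be f g F G s t :
  curve J k al be f g F G -> (forall x, s < x < t -> J x) ->
  (forall s' t', s <= s' -> s' < t' -> t' <= t -> ~ collinear J f g s' t') ->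
  forall w, s < w < t -> active_limit J F G w.
Proof.
move=> cv stJ ncol w wI e e0; apply: contrapT => nact.
pose s' := Num.max s (w - e); pose t' := Num.min t (w + e).
have s1 : s <= s' by rewrite le_max lexx.
have s2 : w - e <= s' by rewrite le_max lexx orbT.
have t1 : t' <= t by rewrite ge_min lexx.
have t2 : t' <= w + e by rewrite ge_min lexx orbT.
have s'w : s' < w by rewrite gt_max; lra.
have wt' : w < t' by rewrite lt_min; lra.
have idle z : s' < z < t' -> ~ active J F G z.
  by move=> zI az; apply: nact; exists z; split=> //; lra.
apply: (ncol s' t') => //; first lra.
apply: (@collinear_base _ _ _ _ (f w) (g w)) => x y [Jx xI] [Jy yI].
have [-> ->] : f x = f w /\ g x = g w.
  by apply: (idle_cst cv idle) => //; [lra|lra|apply: stJ; lra].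
by rewrite !subrr !mul0r.
Qed.

(** Independence of the coefficients is the absence of straight pieces; it is
    what makes the continuation by reflection possible. *)
Lemma regular_model J k al be f g F G s t :
  curve J k al be f g F G -> s < t -> (forall x, s < x < t -> J x) ->
  (forall s' t', s <= s' -> s' < t' -> t' <= t -> ~ collinear J f g s' t') ->
  (forall x, s < x < t -> derivable f x 1) ->
  (forall x, s < x < t -> derivable g x 1) ->
  (forall x, s < x < t -> derive1 g x != 0) ->
  exists e1 e2, [/\ model e1 e2, spanned e1 e2 J f & spanned e1 e2 J g].
Proof.
move=> cv st stJ ncol fd gd g0.
have [al0 be0 albe] := And3 (cv_al cv) (cv_be cv) (cv_albe cv).
have lim := not_collinear_active_limit cv stJ ncol.
have parallel u v u' v' : s < u -> u < v -> v < t ->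
    s < u' -> u' < v' -> v' < t -> al * u + be * v = al * u' + be * v' ->
    (f v - f u) * (g v' - g u') = (g v - g u) * (f v' - f u').
  move=> su uv vt su' uv' vt' E.
  have wI := al_be_mix al0 be0 albe uv.
  have wst : s < al * u + be * v < t by lra.
  by apply: (fiber_parallel cv (stJ _ wst) (lim _ wst)) => //; apply: stJ; lra.
have not_line s' t' c : s <= s' -> s' < t' -> t' <= t ->
    ~ (forall x y, s' < x < t' -> s' < y < t' -> f x - c * g x = f y - c * g y).
  move=> ss st' tt line; apply: (ncol s' t') => //; apply/collinear_onP.
  exists 1, (- c); split; first by left; rewrite oner_eq0.
  by move=> x y [_ xI] [_ yI]; rewrite !mul1r !mulNr; exact: line.
have weights := regular_weights al0 be0 albe st fd gd g0 parallel not_line.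
have [c [odef odeg]] := regular_ode al0 be0 albe st fd gd g0 parallel not_line.
have [e1 [e2 [mod12 sol]]] := ode3_model c.
have [a0 [a1 [a2 fE]]] := sol s t f st odef.
have [b0 [b1 [b2 gE]]] := sol s t g st odeg.
have [d1 [d2 [dd1 [dd2 mp]]]] := model_midpoint mod12.
have indep : a1 * b2 - a2 * b1 != 0.
  apply/eqP => dep; apply: (ncol s t) => // x y z [_ xI] [_ yI] [_ zI].
  apply/eqP; rewrite -subr_eq0 !fE// !gE//; apply/eqP.
  transitivity ((a1 * b2 - a2 * b1) * ((e1 y - e1 x) * (e2 z - e2 x) -
    (e2 y - e2 x) * (e1 z - e1 x))); first by ring.
  by rewrite dep mul0r.
have agree : forall x, J x ->
    f x = a0 + (a1 * e1 x + a2 * e2 x) /\ g x = b0 + (b1 * e1 x + b2 * e2 x).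
  apply: (agree_extends cv weights mp indep st) => x xI.
  by split; [exact: stJ|split; [exact: fE|exact: gE]].
exists e1, e2; split=> //.
  by exists a0, a1, a2 => x /agree[].
by exists b0, b1, b2 => x /agree[].
Qed.

(** The slope [K w] of the chords over [w] near [w0] is read off a translate of
    the chord from [u0] to [v0], along which [f] takes distinct values. *)
Lemma curve_model_neq J k al be f g F G s t u0 v0 :
  curve J k al be f g F G -> (forall x, s < x < t -> J x) ->
  (forall s' t', s <= s' -> s' < t' -> t' <= t -> ~ collinear J f g s' t') ->
  s < u0 -> u0 < v0 -> v0 < t -> f u0 != f v0 ->
  exists e1 e2, [/\ model e1 e2, spanned e1 e2 J f & spanned e1 e2 J g].
Proof.
move=> cv stJ ncol su uv vt fuv.
have [al0 be0 albe] := And3 (cv_al cv) (cv_be cv) (cv_albe cv).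
have lim := not_collinear_active_limit cv stJ ncol.
have fc x : s < x < t -> {for x, continuous f}.
  by move=> xI; apply: (vel_cts (curve_vel1 cv)); exact: stJ.
have u0I : s < u0 < t by lra.
have v0I : s < v0 < t by lra.
have [d [d0 sd dt sep]] : exists d, [/\ 0 < d, s <= u0 - d, v0 + d <= t &
    forall u v, u0 - d < u < u0 + d -> v0 - d < v < v0 + d ->
      u < v /\ f v - f u != 0].
  pose m := (u0 + v0) / 2; have um : s < u0 < m by rewrite /m; lra.
  have mv : m < v0 < t by rewrite /m; lra.
  have c0 : f u0 - (f u0 + f v0) / 2 != 0.
    by apply: contra_neq fuv => E; lra.
  (* the values near [u0] and near [v0] are separated by their mean *)
  have sgn_u : \forall x \near u0, 0 < (f x - (f u0 + f v0) / 2) * (f u0 - f v0).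
    apply: (@cvgr_gt _ _ (nbhs u0) _ (fun x => (f x - (f u0 + f v0) / 2) * (f u0 - f v0))
      ((f u0 - (f u0 + f v0) / 2) * (f u0 - f v0))).
      apply: cvgM; last exact: cvg_cst.
      by apply: cvgB; [exact: fc|exact: cvg_cst].
    rewrite (_ : _ * _ = (f u0 - f v0) ^+ 2 / 2); last by field.
    by rewrite divr_gt0// exprn_even_gt0//= subr_eq0.
  have sgn_v : \forall x \near v0, (f x - (f u0 + f v0) / 2) * (f u0 - f v0) < 0.
    apply: (@cvgr_lt _ _ (nbhs v0) _ (fun x => (f x - (f u0 + f v0) / 2) * (f u0 - f v0))
      ((f v0 - (f u0 + f v0) / 2) * (f u0 - f v0))).
      apply: cvgM; last exact: cvg_cst.
      by apply: cvgB; [exact: fc|exact: cvg_cst].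
    rewrite (_ : _ * _ = - ((f u0 - f v0) ^+ 2 / 2)); last by field.
    by rewrite oppr_lt0 divr_gt0// exprn_even_gt0//= subr_eq0.
  have /near_itvP[d1 d10 P1] : \forall x \near u0, s < x < m /\
      0 < (f x - (f u0 + f v0) / 2) * (f u0 - f v0).
    by move: (near_oo_id um) sgn_u; apply: filterS2.
  have /near_itvP[d2 d20 P2] : \forall x \near v0, m < x < t /\
      (f x - (f u0 + f v0) / 2) * (f u0 - f v0) < 0.
    by move: (near_oo_id mv) sgn_v; apply: filterS2.
  pose d := Num.min (Num.min d1 d2) (Num.min (u0 - s) (t - v0)).
  have dd1 : d <= d1 by rewrite !ge_min lexx.
  have dd2 : d <= d2 by rewrite !ge_min lexx orbT.
  have ds : d <= u0 - s by rewrite !ge_min lexx !orbT.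
  have dt : d <= t - v0 by rewrite !ge_min lexx !orbT.
  exists d; split; [by rewrite !lt_min d10 d20 !subr_gt0 su vt|lra|lra|].
  move=> u v uI vI.
  have [||um' pu] := P1 u; [lra|lra|].
  have [||mv' pv] := P2 v; [lra|lra|].
  split; first lra.
  apply/eqP => /eqP; rewrite subr_eq0 => /eqP E.
  by rewrite E in pv; lra.
pose w0 := al * u0 + be * v0.
pose K w := (g (v0 + (w - w0)) - g (u0 + (w - w0))) /
  (f (v0 + (w - w0)) - f (u0 + (w - w0))).
have wI w : w0 - d < w < w0 + d -> s < w < t.
  by move=> ?; have := al_be_mix al0 be0 albe uv; rewrite -/w0; lra.
have chordK u v w : s < u -> u < v -> v < t -> w = al * u + be * v ->
    w0 - d < w < w0 + d -> g v - g u = K w * (f v - f u).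
  move=> su' uv' vt' wE wd; have wst := wI w wd.
  have [uv1 f0] : u0 + (w - w0) < v0 + (w - w0) /\
    f (v0 + (w - w0)) - f (u0 + (w - w0)) != 0 by apply: sep; lra.
  have E : al * (u0 + (w - w0)) + be * (v0 + (w - w0)) = w.
    transitivity (w0 + (al + be) * (w - w0)); first by rewrite /w0; ring.
    by rewrite albe; ring.
  have := fiber_parallel cv (stJ _ wst) (lim _ wst) (stJ u _) (stJ v _)
    (stJ (u0 + (w - w0)) _) (stJ (v0 + (w - w0)) _) uv' uv1 (esym wE) E.
  move=> /(_ ltac:(lra) ltac:(lra) ltac:(lra) ltac:(lra)) H.
  by apply: (mulIf f0); rewrite -H /K mulrAC divfK// mulrC.
have [||||s1 [t1 [c [s1d st1 t1d fgd q0]]]] :=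
  @regular_subinterval _ al be u0 v0 d f g K al0 be0 albe d0.
- by move=> u v uI vI; exact: (sep u v uI vI).2.
- move=> u v uI vI; have [uv' _] := sep u v uI vI.
  apply: chordK => //; [lra|lra|].
  have p1 : 0 < al * (u - (u0 - d)) by rewrite mulr_gt0 ?subr_gt0//; lra.
  have p2 : 0 < al * (u0 + d - u) by rewrite mulr_gt0 ?subr_gt0//; lra.
  have q1 : 0 < be * (v - (v0 - d)) by rewrite mulr_gt0 ?subr_gt0//; lra.
  have q2 : 0 < be * (v0 + d - v) by rewrite mulr_gt0 ?subr_gt0//; lra.
  have dd : al * d + be * d = d by rewrite -mulrDl albe mul1r.
  by rewrite /w0; lra.
- rewrite -/w0 => x y wx xy yw [c Kc].
  have sx : s <= x by have := al_be_mix al0 be0 albe uv; rewrite -/w0; lra.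
  have yt : y <= t by have := al_be_mix al0 be0 albe uv; rewrite -/w0; lra.
  apply: (ncol x y) => //; apply/collinear_onP.
  exists (- c), 1; split; first by right; rewrite oner_eq0.
  suff lem u v : x < u -> u < v -> v < y -> - c * f u + 1 * g u = - c * f v + 1 * g v.
    move=> u v [_ uI] [_ vI]; have [?|?|->//] := ltgtP u v; first by apply: lem; lra.
    by apply/esym; apply: lem; lra.
  move=> xu uv' vy; have mixI := al_be_mix al0 be0 albe uv'.
  have E : g v - g u = K (al * u + be * v) * (f v - f u).
    by apply: chordK => //; lra.
  rewrite (Kc (al * u + be * v)) in E; last lra.
  apply/eqP; rewrite -subr_eq0; apply/eqP.
  by transitivity (c * (f v - f u) - (g v - g u)); [ring|rewrite E subrr].
- move=> x y vx xy yv.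
  (* [y] may be the right end of the interval, where nothing is known *)
  pose y' := (x + y) / 2; have xy' : x < y' by rewrite /y'; lra.
  have yy' : y' < y by rewrite /y'; lra.
  have sx : s < x.
    rewrite ltNge; apply/negP => xs.
    by have [||] := sep u0 ((x + u0) / 2); lra.
  have Jx : J x by apply: stJ; lra.
  have Jy' : J y' by apply: stJ; lra.
  have [v vI kv] := cv_dense cv xy' Jx Jy'.
  have Jv : J v by apply: stJ; lra.
  exists v; split; first lra.
    exact: (vel_der (curve_vel1 cv) Jv kv).
  exact: (vel_der (curve_vel2 cv) Jv kv).
(* the pair [f, g - c * f] is regular on the interval found *)
have cvq := curve_lin 1 0 (- c) 1 cv.
have fE : (fun x => 1 * f x + 0 * g x) = f by apply/funext => x; ring.
have gE : (fun x => - c * f x + 1 * g x) = (fun x => g x - c * f x).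
  by apply/funext => x; ring.
rewrite fE gE in cvq.
have [|||||e1 [e2 [mod12 sf [b0 [b1 [b2 qE]]]]]] := regular_model cvq st1.
- by move=> x xI; apply: stJ; lra.
- move=> s' t' ss st' tt col; apply: (ncol s' t'); [lra|lra|lra|].
  move=> x y z Sx Sy Sz; have := col x y z Sx Sy Sz => H.
  apply/eqP; rewrite -subr_eq0; apply/eqP.
  move/eqP: H; rewrite -subr_eq0 => /eqP <-; ring.
- by move=> x /fgd[].
- move=> x xI; have [fx gx] := fgd x xI.
  exact: drv_derivable (drvB (derivable_drv gx) (drvZ c (derivable_drv fx))).
- exact: q0.
have [a0 [a1 [a2 fE']]] := sf.
exists e1, e2; split=> //.
exists (b0 + c * a0), (b1 + c * a1), (b2 + c * a2) => x Jx.
have := qE x Jx; rewrite fE'// => E.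
transitivity (g x - c * (a0 + (a1 * e1 x + a2 * e2 x)) +
  c * (a0 + (a1 * e1 x + a2 * e2 x))); first by ring.
by rewrite E; ring.
Qed.

Theorem curve_model J k al be f g F G s t :
  curve J k al be f g F G -> s < t -> (forall x, s < x < t -> J x) ->
  (forall s' t', s <= s' -> s' < t' -> t' <= t -> ~ collinear J f g s' t') ->
  exists e1 e2, [/\ model e1 e2, spanned e1 e2 J f & spanned e1 e2 J g].
Proof.
move=> cv st stJ ncol.
have [u [v [su uv vt]]] : exists u v, [/\ s < u, u < v, v < t &
    f u != f v \/ g u != g v].
  apply: contrapT => /forallNP all; apply: (ncol s t) => //.
  have eq u v : s < u -> u < v -> v < t -> f u = f v /\ g u = g v.
    move=> su uv vt; have /forallNP/(_ v) := all u => H.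
    by split; apply/eqP/negPn/negP => E; apply: H; split=> //; [left|right].
  pose m := (s + t) / 2; have mI : s < m < t by rewrite /m; lra.
  apply: (@collinear_base _ _ _ _ (f m) (g m)) => x y [Jx xI] [Jy yI].
  have [-> ->] : f x = f m /\ g x = g m.
    have [?|?|->//] := ltgtP x m; first by apply: eq; lra.
    by have [-> ->] : f m = f x /\ g m = g x by apply: eq; lra.
  by rewrite !subrr !mul0r.
case=> [fuv|guv]; first exact: (curve_model_neq cv stJ ncol su uv vt fuv).
have [|e1 [e2 [mod12 sg sf]]] := curve_model_neq (curve_swap cv) stJ _ su uv vt guv.
  move=> s' t' ss st' tt col; apply: (ncol s' t') => // x y z Sx Sy Sz.
  by rewrite (col x y z).
by exists e1, e2.
Qed.

End Classification.

(** * Passing to the variable [u = H x] *)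

Section Transport.
Context {R : realType}.
Variables (E : set R) (H L : R -> R).
Hypotheses (E_itv : is_interval E) (E_open : open E).
Hypothesis H_diff : forall x, E x -> derivable H x 1.
Hypothesis H_mono : strictly_monotone_on E H.
Hypothesis LK : forall x, E x -> L (H x) = x.
Implicit Types (x y z u v w a b c e : R) (p q : R -> R).

Let J := H @` E.

Let H_strict x y : E x -> E y -> x < y ->
  (forall z z', E z -> E z' -> z < z' -> H z < H z') /\ H x < H y \/
  (forall z z', E z -> E z' -> z < z' -> H z' < H z) /\ H y < H x.
Proof.
case: H_mono => mono Ex Ey xy; [left|right]; split=> [z z' Ez Ez' zz'|].
- by apply: mono; rewrite ?inE.
- by apply: mono; rewrite ?inE.
- by apply: mono; rewrite ?inE.
- by apply: mono; rewrite ?inE.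
Qed.

Let H_ivt x y v : E x -> E y -> x < y ->
  Num.min (H x) (H y) <= v <= Num.max (H x) (H y) -> exists2 c, x <= c <= y & H c = v.
Proof.
move=> Ex Ey xy vI.
have [|c] := IVT (ltW xy) _ vI; last by rewrite in_itv/=; exists c.
apply: derivable_within_continuous => z; rewrite in_itv/= => zI.
by apply: H_diff; exact: E_itv zI.
Qed.

Let E_near x : E x -> \forall y \near x, E y.
Proof. by move: E_open; rewrite openE => /(_ x) H' /H'. Qed.

Let L_near x e : E x -> 0 < e ->
  \forall v \near H x, [/\ E (L v), H (L v) = v & x - e < L v < x + e].
Proof.
move=> Ex e0; have /near_itvP[e' e'0 He'] := E_near Ex.
pose r := Num.min e e' / 2.
have m0 : 0 < Num.min e e' by rewrite lt_min e0.
have me : Num.min e e' <= e by rewrite ge_min lexx.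
have me' : Num.min e e' <= e' by rewrite ge_min lexx orbT.
have Ea : E (x - r) by apply: He'; rewrite /r; lra.
have Eb : E (x + r) by apply: He'; rewrite /r; lra.
have ax : x - r < x by rewrite /r; lra.
have xb : x < x + r by rewrite /r; lra.
have ab : x - r < x + r by lra.
have between : Num.min (H (x - r)) (H (x + r)) < H x < Num.max (H (x - r)) (H (x + r)).
  rewrite gt_min lt_max.
  have [[mono _]|[mono _]] := H_strict Ea Eb ab.
    by apply/andP; split; apply/orP; [left|right]; apply: mono.
  by apply/andP; split; apply/orP; [right|left]; apply: mono.
have := near_oo_id between; apply: filterS => v vI.
have [|c cI <-] := H_ivt Ea Eb ab (v := v); first lra.
have Ec : E c by apply: (E_itv Ea Eb); lra.
by rewrite LK//; split=> //; rewrite /r in cI; lra.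
Qed.

Let L_cts x : E x -> {for H x, continuous L}.
Proof.
move=> Ex; apply/cvgrPdist_lt => /= e e0; rewrite LK//.
have := L_near Ex e0; apply: filterS => v [_ _ vI].
by rewrite ltr_distlC.
Qed.

Lemma image_itv u v w : J u -> J w -> u <= v <= w -> J v.
Proof.
move=> [x Ex <-] [y Ey <-] vI; have [xy|yx|xy] := ltgtP x y.
- have [|c cI <-] := H_ivt Ex Ey xy (v := v).
    by rewrite ge_min le_max; apply/andP; split; apply/orP; [left|right]; lra.
  by exists c => //; apply: (E_itv Ex Ey).
- have [|c cI <-] := H_ivt Ey Ex yx (v := v).
    by rewrite ge_min le_max; apply/andP; split; apply/orP; [right|left]; lra.
  by exists c => //; apply: (E_itv Ey Ex).
- by exists x => //; move: vI; rewrite xy; lra.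
Qed.

Lemma image_near u : J u -> \forall v \near u, J v.
Proof.
move=> [x Ex <-]; have := L_near Ex ltr01; apply: filterS => v [ELv HLv _].
by exists (L v).
Qed.

(** Differentiability at the end points is what makes [p] continuous there. *)
Let drv0_segment p x y : x < y -> (forall z, x <= z <= y -> derivable p z 1) ->
  (forall z, x < z < y -> derive1 p z = 0) -> p x = p y.
Proof.
move=> xy pd p0; have [||c _] := @MVT R p (fun=> 0) x y xy.
- move=> z; rewrite in_itv/= => /andP[z1 z2].
  by apply: drv_eq (derivable_drv (pd z _)) (p0 z _); lra.
- by apply: derivable_within_continuous => z; rewrite in_itv/=; exact: pd.
- by rewrite mul0r => /eqP; rewrite subr_eq0 => /eqP.
Qed.

Lemma velocity_image p : (forall x, E x -> derivable p x 1) ->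
  velocity J (fun u => derive1 H (L u)) (fun u => p (L u)) (fun u => derive1 p (L u)).
Proof.
move=> pd; split.
- move=> _ [x Ex <-]; apply: (@continuous_comp _ _ _ L p); first exact: L_cts.
  by rewrite LK//; apply: drv_cts (derivable_drv (pd x Ex)).
- move=> _ [x Ex <-]; rewrite LK// => H0.
  have LD : is_derive (H x) 1 L (derive1 H x)^-1.
    apply: is_derive_inverse => //.
    + by have := E_near Ex; apply: filterS => y; exact: LK.
    + have := E_near Ex; apply: filterS => y /H_diff/derivable_drv; exact: drv_cts.
    + exact: derivable_drv (H_diff Ex).
  have pD := derivable_drv (pd x Ex); rewrite -[x in is_derive x](LK Ex) in pD.
  exact: drv_derivable (drv_comp pD LD).
- move=> _ d [x Ex <-] dD; rewrite LK//.
  have Hx := derivable_drv (H_diff Ex).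
  have := drv_comp dD Hx => D; apply: drv1; apply: drv_near D.
  by have := E_near Ex; apply: filterS => y /LK ->.
- move=> u v + [x Ex ux] [y Ey vy] p0; rewrite -ux -vy in p0 *; rewrite !LK// => Hxy.
  have pE z : E z -> H x < H z < H y -> derive1 p z = 0.
    by move=> Ez /p0; rewrite LK.
  have [xy|yx|xy] := ltgtP x y; last by move: Hxy; rewrite xy ltxx.
    apply: drv0_segment => // z zI; have Ez : E z by apply: (E_itv Ex Ey); lra.
      exact: pd.
    apply: pE => //; have [[mono _]|[_ ]] := H_strict Ex Ey xy; last by lra.
    by rewrite !mono//; lra.
  apply/esym/drv0_segment => // z zI; have Ez : E z by apply: (E_itv Ey Ex); lra.
    exact: pd.
  apply: pE => //; have [[_ ]|[mono _]] := H_strict Ey Ex yx; first by lra.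
  by rewrite !mono//; lra.
Qed.

(** The zeros of [H'] have empty interior, since [H] is injective. *)
Let speed_dense u v : u < v -> J u -> J v -> exists2 w, u < w < v & derive1 H (L w) != 0.
Proof.
move=> uv Ju Jv; apply: contrapT => none.
have := vel_flat (velocity_image H_diff) uv Ju Jv.
case: Ju => x Ex ux; case: Jv => y Ey vy; rewrite -ux -vy in uv none *; rewrite !LK// => flat.
suff HE : H x = H y by rewrite HE ltxx in uv.
apply: flat => w wI; apply/eqP/negPn/negP => w0.
by apply: none; exists w.
Qed.

(** A decreasing [H] exchanges the endpoints of chords, hence the weights. *)
Lemma curve_of_equation (al be : R) (h : R -> R -> R) (phi psi : R -> R) :
  0 < al -> 0 < be -> al + be = 1 ->
  (forall x y, E x -> E y -> h x y = L (al * H x + be * H y)) ->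
  (forall x, E x -> derivable phi x 1) -> (forall x, E x -> derivable psi x 1) ->
  (forall x y, E x -> E y -> x < y ->
    (phi y - phi x) * derive1 psi (h x y) = (psi y - psi x) * derive1 phi (h x y)) ->
  exists al' be', curve J (fun u => derive1 H (L u)) al' be'
    (fun u => phi (L u)) (fun u => psi (L u))
    (fun u => derive1 phi (L u)) (fun u => derive1 psi (L u)).
Proof.
move=> al0 be0 albe hE phid psid eqn.
have vel a b : velocity J (fun u => derive1 H (L u))
    (fun x => a * phi (L x) + b * psi (L x))
    (fun x => a * derive1 phi (L x) + b * derive1 psi (L x)).
  pose p x := a * phi x + b * psi x.
  have pD x : E x -> is_derive x 1 p (a * derive1 phi x + b * derive1 psi x).
    move=> Ex; exact: drvD (drvZ a (derivable_drv (phid x Ex)))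
      (drvZ b (derivable_drv (psid x Ex))).
  have pd x : E x -> derivable p x 1 by move=> /pD/drv_derivable.
  have [c1 c2 c3 c4] := velocity_image pd; split=> //.
    move=> _ d [x Ex <-] dD; have := c3 (H x) d (ex_intro2 _ _ x Ex erefl) dD.
    by rewrite LK// (drv1 (pD x Ex)).
  move=> u v uv Ju Jv p0; apply: (c4 u v uv Ju Jv) => w wI.
  have [x Ex xw] : J w by apply: image_itv Ju Jv _; lra.
  by have := p0 w wI; rewrite -xw LK// (drv1 (pD x Ex)).
case: (H_mono) => mono.
- exists al, be; split=> //; [exact: image_itv|exact: image_near|].
  move=> _ _ [x Ex <-] [y Ey <-] Hxy.
  rewrite -hE// !LK//; apply: eqn => //.
  have [//|yx|xy] := ltgtP x y; last by move: Hxy; rewrite xy ltxx.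
  have : H y < H x by apply: mono; rewrite ?inE.
  by lra.
- exists be, al; split=> //; [exact: image_itv|exact: image_near|by rewrite addrC|].
  move=> _ _ [x Ex <-] [y Ey <-] Hxy.
  rewrite [be * _ + _]addrC -hE// !LK//.
  have yx : y < x.
    have [xy|//|xy] := ltgtP x y; last by move: Hxy; rewrite xy ltxx.
    have : H y < H x by apply: mono; rewrite ?inE.
    by lra.
  by rewrite -opprB mulNr eqn// -mulNr opprB.
Qed.

End Transport.

Section LinearDependence.
Context {R : realType}.
Implicit Types (S : set R) (f g p : R -> R).

Lemma lin_dep3 S f g a b c : (a != 0 \/ b != 0 \/ c != 0) ->
  (forall x, S x -> a + (b * f x + c * g x) = 0) ->
  lin_dep_on S [tuple cst 1; f; g].
Proof.
move=> abc0 dep; exists (fun i : 'I_3 => nth 0 [:: a; b; c] i).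
  case: abc0 => [a0|[b0|c0]].
  - by exists (@Ordinal 3 0 isT).
  - by exists (@Ordinal 3 1 isT).
  - by exists (@Ordinal 3 2 isT).
move=> x /dep E; rewrite -[RHS]E.
by rewrite !big_ord_recl big_ord0 /= !(tnth_nth (cst 0)) /= mulr1 addr0.
Qed.

Lemma in_span3 S f g p : (exists a b c, forall x, S x -> p x = a + (b * f x + c * g x)) ->
  in_span_on S [tuple cst 1; f; g] p.
Proof.
move=> [a [b [c pE]]]; exists (fun i : 'I_3 => nth 0 [:: a; b; c] i) => x /pE ->.
by rewrite !big_ord_recl big_ord0 /= !(tnth_nth (cst 0)) /= mulr1 addr0.
Qed.

End LinearDependence.

(** * The four possibilities *)

Lemma collinear_reflect_on {R : realType} (J : set R) (f g : R -> R) :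
  collinear_on (fun x => J (- x)) (fun x => f (- x)) (fun x => g (- x)) ->
  collinear_on J f g.
Proof.
move=> col x y z Jx Jy Jz; have := col (- x) (- y) (- z).
by rewrite /= !opprK; apply.
Qed.

Lemma collinear_lin_dep {R : realType} (E : set R) (H L phi psi : R -> R) :
  (forall x, E x -> L (H x) = x) ->
  collinear_on (H @` E) (fun u => phi (L u)) (fun u => psi (L u)) ->
  lin_dep_on E [tuple cst 1; phi; psi].
Proof.
move=> LK /collinear_onP[a [b [ab0 line]]].
have [[x0 Ex0]|E0] := pselect (exists x, E x); last first.
  by apply: (@lin_dep3 _ _ _ _ 1 0 0) => [|x Ex]; [left; rewrite oner_eq0|case: E0; exists x].
apply: (@lin_dep3 _ _ _ _ (- (a * phi x0 + b * psi x0)) a b); first by right.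
move=> x Ex; have := line (H x) (H x0) (imageP H Ex) (imageP H Ex0).
by rewrite !LK// => ->; rewrite addNr.
Qed.

(** An interval contains a shorter one whose end points it contains, so that
    statements about straight pieces with both ends in [J] apply. *)
Lemma collinear_shrink {R : realType} (J : set R) (f g : R -> R) (s t : R) :
  s < t -> (forall x, s < x < t -> J x) -> collinear J f g s t ->
  exists s' t', [/\ s < s', s' < t' & t' < t] /\
    [/\ J s', J t' & collinear J f g s' t'].
Proof.
move=> st stJ col; exists ((2 * s + t) / 3), ((s + 2 * t) / 3).
split; first by split; lra.
split; [apply: stJ; lra|apply: stJ; lra|].
by apply: collinear_sub col; lra.
Qed.

Lemma unbounded_above_up {R : realType} (J : set R) :
  (forall x y z, J x -> J z -> x <= y <= z -> J y) ->
  ereal_sup (EFin @` J) = +oo%E -> forall x y, J x -> x <= y -> J y.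
Proof.
move=> itvJ supJ x y Jx xy.
have [z [Jz yz]] : exists z, J z /\ y < z.
  apply: contrapT => /forallNP all.
  suff : (ereal_sup (EFin @` J) <= y%:E)%E by rewrite supJ.
  apply: ge_ereal_sup => _ [z Jz <-]; rewrite lee_fin leNgt; apply/negP => yz.
  by apply: (all z).
by apply: (itvJ x y z) => //; rewrite xy ltW.
Qed.

Lemma unbounded_below_down {R : realType} (J : set R) :
  (forall x y z, J x -> J z -> x <= y <= z -> J y) ->
  ereal_inf (EFin @` J) = -oo%E -> forall x y, J x -> y <= x -> J y.
Proof.
move=> itvJ infJ x y Jx yx.
have [z [Jz zy]] : exists z, J z /\ z < y.
  apply: contrapT => /forallNP all.
  suff : (y%:E <= ereal_inf (EFin @` J))%E by rewrite infJ.
  apply: le_ereal_inf_tmp => _ [z Jz <-]; rewrite lee_fin leNgt; apply/negP => zy.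
  by apply: (all z).
by apply: (itvJ z y x) => //; rewrite yx ltW.
Qed.

Theorem theorem1 (R : realType) (E : set R)
  (E_itv : is_interval E) (E_open : open E) (E_neq0 : E !=set0)
  (H : R -> R)
  (H_diff : forall x, E x -> derivable H x 1)
  (H_mono : strictly_monotone_on E H)
  (alpha beta : R)
  (alpha01 : 0 < alpha < 1) (beta01 : 0 < beta < 1)
  (alpha_beta : alpha + beta = 1)
  (h : R -> R -> R)
  (h_def : forall x y, E x -> E y ->
     h x y = pinv E H (alpha * H x + beta * H y))
  (phi psi : R -> R)
  (phi_diff : forall x, E x -> derivable phi x 1)
  (psi_diff : forall x, E x -> derivable psi x 1)
  (phi_psi : forall x y, E x -> E y -> x < y ->
     (phi y - phi x) * derive1 psi (h x y) = (psi y - psi x) * derive1 phi (h x y)) :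
  [\/ (forall I : set R, is_interval I -> open I -> I `<=` E ->
         (forall x, I x -> derive1 psi x != 0) ->
         lin_dep_on I [tuple cst 1; phi; psi]) /\
      (semi_infinite (H @` E) -> lin_dep_on E [tuple cst 1; phi; psi]),
      in_span_on E [tuple cst 1; H; (fun x => H x ^+ 2)] phi /\
      in_span_on E [tuple cst 1; H; (fun x => H x ^+ 2)] psi,
      exists mu : R, [/\ mu != 0,
        in_span_on E [tuple cst 1; (fun x => expR (mu * H x));
                                   (fun x => expR (- mu * H x))] phi &
        in_span_on E [tuple cst 1; (fun x => expR (mu * H x));
                                   (fun x => expR (- mu * H x))] psi] |
      exists mu : R, [/\ mu != 0,
        in_span_on E [tuple cst 1; (fun x => sin (mu * H x));
                                   (fun x => cos (mu * H x))] phi &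
        in_span_on E [tuple cst 1; (fun x => sin (mu * H x));
                                   (fun x => cos (mu * H x))] psi]].

Proof.
have [al0 _] := andP alpha01; have [be0 _] := andP beta01.
pose L := pinv E H.
have H_inj : {in E &, injective H}.
  move=> x y xE yE Hxy; have [xy|yx|//] := ltgtP x y; case: H_mono => mono.
  - by have := mono x y xE yE xy; rewrite Hxy ltxx.
  - by have := mono y x yE xE xy; rewrite Hxy ltxx.
  - by have := mono y x yE xE yx; rewrite Hxy ltxx.
  - by have := mono x y xE yE yx; rewrite Hxy ltxx.
have LK x : E x -> L (H x) = x by move=> Ex; apply: pinvKV => //; rewrite inE.
have [al' [be' cv]] := curve_of_equation E_itv E_open H_diff H_mono LK al0 be0
  alpha_beta h_def phi_diff psi_diff phi_psi.
set J := H @` E in cv *.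
have [[s [t [st stJ ncol]]]|all_col] := pselect (exists s t, [/\ s < t,
  (forall x, s < x < t -> J x) &
  forall s' t', s <= s' -> s' < t' -> t' <= t ->
    ~ collinear J (fun u => phi (L u)) (fun u => psi (L u)) s' t']).
  have [e1 [e2 [mod12 sphi spsi]]] := curve_model cv st stJ ncol.
  have on_E p : spanned e1 e2 J (fun u => p (L u)) ->
      exists a b c, forall x, E x -> p x = a + (b * e1 (H x) + c * e2 (H x)).
    move=> [a [b [c pE]]]; exists a, b, c => x Ex.
    by rewrite -pE ?LK//; exists x.
  have {sphi} sphi := on_E _ sphi; have {spsi} spsi := on_E _ spsi.
  case: mod12 sphi spsi => [|mu mu0|mu mu0] sphi spsi.
  - by apply: Or42; split; exact: in_span3.
  - by apply: Or43; exists mu; split=> //; exact: in_span3.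
  - by apply: Or44; exists mu; split=> //; exact: in_span3.
have straight s t : s < t -> (forall x, s < x < t -> J x) -> exists s' t',
    [/\ s < s', s' < t' & t' < t] /\ [/\ J s', J t' &
    collinear J (fun u => phi (L u)) (fun u => psi (L u)) s' t'].
  move=> st stJ; apply: contrapT => none; apply: all_col.
  exists s, t; split=> // s' t' ss st' tt col.
  have [|s2 [t2 [[? ? ?] [? ? ?]]]] := collinear_shrink st' _ col.
    by move=> x xI; apply: stJ; lra.
  by apply: none; exists s2, t2; split; split=> //; lra.
have around x : J x -> exists s t, s < t /\ forall y, s < y < t -> J y.
  move=> /(cv_open cv)/near_itvP[e e0 eJ]; exists (x - e), (x + e).
  by split=> [|y /andP[]]; [lra|exact: eJ].
apply: Or41; split.
- move=> I I_itv I_open IE psi0.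
  have [[x0 Ix0]|I0] := pselect (exists x, I x); last first.
    by apply: (@lin_dep3 _ _ _ _ 1 0 0) => [|x Ix]; [left; rewrite oner_eq0|case: I0; exists x].
  have HI_mono : strictly_monotone_on I H.
    by case: H_mono => mono; [left|right] => x y; rewrite !inE => Ix Iy; apply: mono;
      rewrite inE; exact: IE.
  have [al2 [be2 cvI]] := curve_of_equation I_itv I_open (fun x Ix => H_diff x (IE x Ix))
    HI_mono (fun x Ix => LK x (IE x Ix)) al0 be0 alpha_beta
    (fun x y Ix Iy => h_def x y (IE x Ix) (IE y Iy))
    (fun x Ix => phi_diff x (IE x Ix)) (fun x Ix => psi_diff x (IE x Ix))
    (fun x y Ix Iy => phi_psi x y (IE x Ix) (IE y Iy)).
  apply: (@collinear_lin_dep _ I H L) => [x /IE/LK//|].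
  have IJ u : (H @` I) u -> J u by move=> [x /IE Ex <-]; exists x.
  have /near_itvP[e e0 eI] := cv_open cvI (imageP H Ix0).
  have [||s [t [[s1 st t1] [_ _ col]]]] := straight (H x0 - e) (H x0 + e); first lra.
    by move=> y /andP[y1 y2]; apply: IJ; exact: eI.
  apply: (collinear_active cvI _ st).
  + move=> _ [x Ix <-]; split; first by exists x.
    by right; rewrite LK ?psi0//; exact: IE.
  + by apply: eI; lra.
  + by apply: eI; lra.
  + move=> x y z [Jx xI] [Jy yI] [Jz zI].
    by apply: col; split => //; exact: IJ.
- move=> semi; apply: (@collinear_lin_dep _ E H L) => //.
  have [x0 Ex0] := E_neq0.
  have [s0 [t0 [st0 stJ0]]] := around _ (imageP H Ex0).
  have [s [t [[s1 st t1] [Js Jt col]]]] := straight _ _ st0 stJ0.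
  case: semi => [infJ|supJ]; last first.
    exact: (collinear_unbounded cv (unbounded_above_up (cv_itv cv) supJ) st Js col).
  apply: collinear_reflect_on.
  have down := unbounded_below_down (cv_itv cv) infJ.
  apply: (collinear_unbounded (curve_reflect cv) (s := - t) (t := - s)).
  + by move=> x y Jx xy; apply: down Jx _; rewrite lerN2.
  + by rewrite ltrN2.
  + by rewrite opprK.
  + exact: (collinear_reflect _ _ _ _ _).1 col.
Qed.
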